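(* Let $\varepsilon > 0$ and let $\mu$ be the multiplicative function on the positive integers defined by $$\mu(p^i) = 1 + \frac{(\log p)^{3+\varepsilon}}{p}$$ for all primes $p$ and integers $i \ge 1$. There exists $M > 0$ (depending only on $\varepsilon$) such that the following holds. If $A_1,\dots,A_k$ are arithmetic progressions (full residue classes $A_i = a_i + d_i\mathbb{Z}$) with distinct moduli $d_1,\dots,d_k \ge M$, and $$C = \sum_{i=1}^k \frac{\mu(d_i)}{d_i},$$ then the density of the uncovered set $R := \mathbb{Z} \setminus \bigcup_{i=1}^k A_i$ is at least $e^{-4C}/2$.
   Context: An arithmetic progression with modulus $d$ is a set of the form $a + d\mathbb{Z}$ with $a \in \mathbb{Z}$, $d \in \mathbb{N}$. The uncovered set $R$ is periodic, and its density is the proportion of residue classes modulo $\mathrm{lcm}(d_1,\dots,d_k)$ that it contains. Here $\log$ is the natural logarithm, and ''multiplicative'' means $\mu(1)=1$ and $\mu(mn)=\mu(m)\mu(n)$ whenever $\gcd(m,n)=1$. *)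

(* Defs.v *)
From HB Require Import structures.
From mathcomp Require Import all_boot all_order all_algebra.
From mathcomp Require Import all_classical all_reals all_analysis.
Set Implicit Arguments.
Unset Strict Implicit.
Unset Printing Implicit Defensive.
Import Order.TTheory GRing.Theory Num.Theory.
Local Open Scope classical_set_scope.
Local Open Scope ring_scope.

(* Arithmetic functions are represented on nat; their value at 0 is never
   constrained. *)
Definition multiplicative_function (R : realType) (mu : nat -> R) : Prop :=
  mu 1%N = 1 /\
  forall m n : nat, (0 < m)%N -> (0 < n)%N -> coprime m n ->
    mu (m * n)%N = mu m * mu n.

Definition prime_power_weight (R : realType) (eps : R) (mu : nat -> R) : Prop :=
  forall p i : nat, prime p -> (1 <= i)%N ->
    mu (p ^ i)%N = 1 + ln (p%:R : R) `^ (3 + eps) / p%:R.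

Definition arith_prog (a : int) (d : nat) : set int :=
  [set x | exists z : int, x = a + d%:Z * z].

Definition uncovered (k : nat) (a : 'I_k -> int) (d : 'I_k -> nat) : set int :=
  ~` (\bigcup_i arith_prog (a i) (d i)).

Definition lcm_moduli (k : nat) (d : 'I_k -> nat) : nat :=
  \big[lcmn/1%N]_(i < k) d i.

(* Meaningful when 0 < Q and S is Q-periodic. *)
Definition density_mod (R : realType) (Q : nat) (S : set int) : R :=
  #|[pred r : 'I_Q | `[< arith_prog (r : nat)%:Z Q `<=` S >]]|%:R / Q%:R.

(* By unique factorization, such a mu is also unique on the positive integers. *)
Lemma prime_power_weight_exists (R : realType) (eps : R) :
  exists mu : nat -> R, multiplicative_function mu /\ prime_power_weight eps mu.
Proof.
pose w (p : nat) : R := 1 + ln (p%:R : R) `^ (3 + eps) / p%:R.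
exists (fun n => \prod_(p <- primes n) w p); split; first split.
- by rewrite big_nil.
- move=> m n m0 n0 cmn; rewrite -big_cat; apply: perm_big.
  apply: uniq_perm; first exact: primes_uniq.
    rewrite cat_uniq !primes_uniq andbT /=.
    by rewrite -coprime_has_primes.
  by move=> p; rewrite mem_cat primesM.
- by move=> p i pp i0; rewrite primesX // primes_prime // big_seq1.
Qed.

(* Main.v *)
(* The distortion method.  Treat the primes n in increasing order, writing q n
   for the part of Q = lcm (d_i) composed of primes below n, and B n for the
   union of the progressions whose modulus has largest prime factor n.
   Starting from the uniform probability on Z/Q, at step n reweight each
   residue class mod q n so as to remove the mass of B n where its conditional
   probability alpha n is at most delta n, and to decrease it as much as a
   density factor 1 / (1 - delta n) allows elsewhere.  The reweighting keeps
   the mass of every class mod q n, so B n finally has mass at most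
   E[alpha n ^ 2] / (2 delta n), or E[alpha n] if delta n = 0.
   With 1 / (1 - delta p) <= mu p, a progression mod m has mass at most
   mu m / m; hence E[alpha n ^ 2] is at most (n - 1)^-2 times the sum of
   mu(l) / l, l = lcm (u, v), over u, v | q n, that is O((ln n)^3 / n^2) by
   Mertens' estimate for the sum of 1 / p.  Taking delta p proportional to
   (ln p)^(3 + eps) / p for large p and 0 for small p, the total mass of the
   B n is at most 1/2: the large primes contribute a tail of the convergent
   sum of 1 / (p (ln p)^eps), the small ones a tail of the sum of 1 / d over
   smooth d >= M.  The final measure thus gives mass at least 1/2 to R, where
   its density is at most exp (2 sum alpha n), with E[sum alpha n] <= C. *)
Require Import Defs.
From HB Require Import structures.
From mathcomp Require Import all_boot all_order all_algebra.
From mathcomp Require Import ring lra zify.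
From mathcomp Require Import all_classical all_reals all_analysis.
Set Implicit Arguments.
Unset Strict Implicit.
Unset Printing Implicit Defensive.
Import Order.TTheory GRing.Theory Num.Theory.
Local Open Scope classical_set_scope.
Local Open Scope ring_scope.

(** * The distorted measures *)

(** Functions and sets on [Z/m] are encoded on [nat] by this invariance, so that those for different
    moduli share one type. *)
Definition periodic (T : Type) (m : nat) (f : nat -> T) : Prop :=
  forall x y : nat, x = y %[mod m] -> f x = f y.

Lemma periodic_dvd (T : Type) (m n : nat) (f : nat -> T) :
  (m %| n)%N -> periodic m f -> periodic n f.
Proof.
move=> mn fm x y xy; apply: fm.
by rewrite -(modn_dvdm x mn) xy modn_dvdm.
Qed.

Lemma card_residue_class (Q m x : nat) : (0 < Q)%N -> (m %| Q)%N ->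
  (\sum_(y < Q | y == x %[mod m]) 1)%N = (Q %/ m)%N.
Proof.
move=> Q0 /dvdnP [k Qk]; rewrite Qk mulnC.
have m0 : (0 < m)%N by move: Q0; rewrite Qk; case: (m) => //; rewrite muln0.
rewrite mulKn // {Q Qk Q0}.
rewrite -(big_mkord (fun y => y == x %[mod m]) (fun=> 1%N)).
elim: k => [|k IHk]; first by rewrite muln0 big_geq.
rewrite mulnS addnC (big_cat_nat (n := (m * k)%N)) ?leq_addr //=.
rewrite IHk -{1}[(m * k)%N]add0n big_addn addKn -[RHS]addn1.
congr addn; rewrite big_mkord.
under eq_bigl => i do rewrite addnC mulnC modnMDl.
rewrite (bigD1 (Ordinal (ltn_pmod x m0))) /= ?modn_mod //.
rewrite big1 // => i /andP [/eqP ix /eqP]; case.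
by apply: val_inj => /=; rewrite -ix modn_small.
Qed.

(** * Averages and conditional averages modulo [Q] *)

Section Means.
Variables (R : realType) (Q : nat).
Hypothesis Q_gt0 : (0 < Q)%N.
Implicit Types (m : nat) (f g h : nat -> R).

Definition mean f : R := (\sum_(x < Q) f x) / Q%:R.

(* The conditional expectation of f given the residue of x modulo m. *)
Definition cmean m f (x : nat) : R :=
  m%:R / Q%:R * \sum_(y < Q | y == x %[mod m]) f y.

Lemma Q_neq0 : Q%:R != 0 :> R.
Proof. by rewrite pnatr_eq0 -lt0n. Qed.

Lemma sum_residue_class m x : (m %| Q)%N ->
  \sum_(y < Q | y == x %[mod m]) 1 = Q%:R / m%:R :> R.
Proof.
move=> mQ; have m0 : m%:R != 0 :> R by rewrite pnatr_eq0 -lt0n (dvdn_gt0 Q_gt0).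
transitivity ((\sum_(y < Q | y == x %[mod m]) 1)%N%:R : R).
  by rewrite natr_sum; apply: eq_bigr.
rewrite card_residue_class //; apply: (mulIf m0).
by rewrite -natrM divnK // divfK.
Qed.

Lemma eq_mean f g : (forall x, f x = g x) -> mean f = mean g.
Proof. by move=> fg; rewrite /mean; under eq_bigr do rewrite fg. Qed.

Lemma ler_mean f g : (forall x, f x <= g x) -> mean f <= mean g.
Proof. by move=> fg; rewrite /mean ler_pM2r ?invr_gt0 ?ltr0n // ler_sum. Qed.

Lemma mean_ge0 f : (forall x, 0 <= f x) -> 0 <= mean f.
Proof. by move=> f0; rewrite /mean divr_ge0 ?ler0n ?sumr_ge0. Qed.

Lemma meanZ c f : mean (fun x => c * f x) = c * mean f.
Proof. by rewrite /mean -mulr_sumr mulrA. Qed.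

Lemma meanD f g : mean (fun x => f x + g x) = mean f + mean g.
Proof. by rewrite /mean big_split /= mulrDl. Qed.

Lemma mean_sum (I : Type) (r : seq I) (p : pred I) (F : I -> nat -> R) :
  mean (fun x => \sum_(i <- r | p i) F i x) = \sum_(i <- r | p i) mean (F i).
Proof. by rewrite /mean exchange_big /= mulr_suml. Qed.

Lemma mean1 : mean (fun=> 1) = 1.
Proof. by rewrite /mean sumr_const card_ord divff // Q_neq0. Qed.

Lemma cmean_periodic m f : periodic m (cmean m f).
Proof. by move=> x y xy; rewrite /cmean; under eq_bigl do rewrite xy. Qed.

Lemma eq_cmean m f g x :
  (forall y, y = x %[mod m] -> f y = g y) -> cmean m f x = cmean m g x.
Proof.
move=> fg; rewrite /cmean; congr (_ * _).
by apply: eq_bigr => y /eqP; apply: fg. Qed.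

Lemma ler_cmean m f g x :
  (forall y, f y <= g y) -> cmean m f x <= cmean m g x.
Proof.
by move=> fg; rewrite ler_wpM2l ?divr_ge0 ?ler0n //; apply: ler_sum.
Qed.

Lemma cmean_affine m u v f x : (m %| Q)%N ->
  cmean m (fun y => u + v * f y) x = u + v * cmean m f x.
Proof.
move=> mQ; have m0 : m%:R != 0 :> R by rewrite pnatr_eq0 -lt0n (dvdn_gt0 Q_gt0).
rewrite /cmean big_split /= mulrDr -[in X in _ + X]mulr_sumr [X in _ + X]mulrCA.
congr (_ + _); rewrite (eq_bigr (fun=> u * 1)) => [|i _]; last by rewrite mulr1.
rewrite -mulr_sumr sum_residue_class //; field.
by rewrite m0 Q_neq0.
Qed.

Lemma cmean_sum (I : Type) (r : seq I) (p : pred I) (F : I -> nat -> R) m x :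
  cmean m (fun y => \sum_(i <- r | p i) F i y) x
  = \sum_(i <- r | p i) cmean m (F i) x.
Proof. by rewrite /cmean exchange_big /= mulr_sumr. Qed.

(** Tower property: after the sums are exchanged, each [y] is counted once for every [x] in its
    class mod [m], that is [Q / m] times, which cancels the factor [m / Q]. *)
Lemma mean_cmean m h f : (m %| Q)%N -> periodic m h ->
  mean (fun x => h x * cmean m f x) = mean (fun x => h x * f x).
Proof.
move=> mQ hm; have m0 : m%:R != 0 :> R.
  by rewrite pnatr_eq0 -lt0n (dvdn_gt0 Q_gt0).
congr (_ / _); rewrite /cmean.
transitivity (\sum_(x < Q) \sum_(y < Q | y == x %[mod m])
                h y * f y * (m%:R / Q%:R) * 1).
  apply: eq_bigr => x _; rewrite mulrCA mulr_sumr mulr_sumr.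
  by apply: eq_bigr => y /eqP yx; rewrite (hm y x yx) mulr1 mulrC.
rewrite (exchange_big_dep predT) //=; apply: eq_bigr => y _.
under eq_bigl do rewrite eq_sym.
rewrite -mulr_sumr sum_residue_class // -[RHS]mulr1 -mulrA.
by congr (_ * _); field; rewrite m0 Q_neq0.
Qed.

End Means.

(** * Successive reweightings and the mass they leave on each [B n] *)

Section Distortion.
Variables (R : realType) (Q : nat) (q : nat -> nat) (B : nat -> pred nat).
Variable delta : nat -> R.
Hypothesis Q_gt0 : (0 < Q)%N.
Hypothesis q_dvdQ : forall n, (q n %| Q)%N.
Hypothesis q_chain : forall n, (q n %| q n.+1)%N.
Hypothesis B_periodic : forall n, periodic (q n.+1) (B n).
Hypothesis delta_ge0 : forall n, 0 <= delta n.
Hypothesis delta_le : forall n, delta n <= 2^-1.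

Local Notation b := (fun n x => (B n x)%:R).

(** The average is uniform, yet on classes of positive mass it is also the conditional probability
    under the current measure, because [weight n] is constant on classes mod [q n]. *)
Definition alpha n : nat -> R := cmean Q (q n) (b n).

(** The conditional mass to be taken off [B n]; dividing by [1 - excess] then restores the mass of
    the class. *)
Definition excess n x : R := Num.min (alpha n x) (delta n).

(* The two cases of the usual definition of the distorted measure are merged:
   the factor excess / alpha is 1 if alpha < delta and delta / alpha
   otherwise; it is 0 if alpha = 0, when B n misses the whole class of x. *)
Definition distortion n x : R :=
  (1 - b n x * (excess n x / alpha n x)) / (1 - excess n x).

Definition weight n x : R := \prod_(i < n) distortion i x.

Definition expect n (f : nat -> R) : R := mean Q (fun x => weight n x * f x).

Lemma q_dvd m n : (m <= n)%N -> (q m %| q n)%N.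
Proof.
elim: n => [|n IHn]; first by rewrite leqn0 => /eqP ->.
rewrite leq_eqVlt => /predU1P [-> //|]; rewrite ltnS => mn.
exact: dvdn_trans (IHn mn) (q_chain n).
Qed.

Lemma alpha_ge0 n x : 0 <= alpha n x.
Proof. by rewrite mulr_ge0 ?divr_ge0 ?ler0n ?sumr_ge0. Qed.

Lemma alpha_periodic n : periodic (q n) (alpha n).
Proof. exact: cmean_periodic. Qed.

Lemma excess_periodic n : periodic (q n) (excess n).
Proof. by move=> x y xy; rewrite /excess (alpha_periodic xy). Qed.

Lemma excess_ge0 n x : 0 <= excess n x.
Proof. by rewrite le_min alpha_ge0 delta_ge0. Qed.

Lemma excess_le_alpha n x : excess n x <= alpha n x.
Proof. by rewrite ge_min lexx. Qed.

Lemma excess_le_delta n x : excess n x <= delta n.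
Proof. by rewrite ge_min lexx orbT. Qed.

Lemma subr1_excess_gt0 n x : 0 < 1 - excess n x.
Proof. have := excess_le_delta n x; have := delta_le n; lra. Qed.

Lemma alpha_excess n x : alpha n x * (excess n x / alpha n x) = excess n x.
Proof.
(* If [alpha] is 0, the quotient is 0 by convention, and [excess], squeezed between 0 and [alpha],
   is 0 as well. *)
have [a0|a0] := eqVneq (alpha n x) 0; last by rewrite mulrC divfK.
apply/eqP; rewrite a0 mul0r eq_sym eq_le excess_ge0 andbT -a0.
exact: excess_le_alpha.
Qed.

Lemma excess_div_alpha n x : 0 <= excess n x / alpha n x <= 1.
Proof.
rewrite divr_ge0 ?excess_ge0 ?alpha_ge0 //=.
have [->|a0] := eqVneq (alpha n x) 0; first by rewrite invr0 mulr0.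
by rewrite ler_pdivrMr ?mul1r ?excess_le_alpha // lt0r a0 alpha_ge0.
Qed.

Lemma distortion_ge0 n x : 0 <= distortion n x.
Proof.
rewrite divr_ge0 ?(ltW (subr1_excess_gt0 _ _)) // subr_ge0.
by have /andP [] := excess_div_alpha n x; case: (B n x); rewrite ?mul1r ?mul0r.
Qed.

Lemma distortion_le n x : distortion n x <= (1 - delta n)^-1.
Proof.
have s0 := subr1_excess_gt0 n x.
apply: (@le_trans _ _ (1 - excess n x)^-1).
  rewrite ler_pdivrMr // mulVf ?gt_eqF // gerBl.
  by rewrite mulr_ge0 ?ler0n //; case/andP: (excess_div_alpha n x).
rewrite lef_pV2 ?posrE //; first by have := excess_le_delta n x; lra.
by have := delta_le n; lra.
Qed.

Lemma distortion_delta0 n x : delta n = 0 -> distortion n x = 1.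
Proof.
move=> d0; have -> : distortion n x = (1 - b n x * (0 / alpha n x)) / (1 - 0).
  congr ((1 - _ * (_ / _)) / (1 - _)); apply/eqP; rewrite eq_le excess_ge0.
    by rewrite -{1}d0 excess_le_delta.
  by rewrite -{1}d0 excess_le_delta.
by rewrite mul0r mulr0 subr0 divr1.
Qed.

Lemma distortion_periodic n : periodic (q n.+1) (distortion n).
Proof.
move=> x y xy.
have xy' : x = y %[mod q n] by exact: periodic_dvd (q_chain n) (fun _ _ => id)
  _ _ xy.
by rewrite /distortion (B_periodic xy) (excess_periodic xy') (alpha_periodic xy').
Qed.

Lemma weight_ge0 n x : 0 <= weight n x.
Proof. by apply: prodr_ge0 => i _; exact: distortion_ge0. Qed.

Lemma weightS n x : weight n.+1 x = weight n x * distortion n x.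
Proof. by rewrite /weight big_ord_recr. Qed.

Lemma weight_periodic n : periodic (q n) (weight n).
Proof.
move=> x y xy; apply: eq_bigr => i _; apply: (periodic_dvd _ _ xy).
- exact: q_dvd (ltn_ord i).
- exact: distortion_periodic.
Qed.

(** Since [weight n] is constant on classes mod [q n], integration against it sees only averages
    over these classes. *)
Lemma expect_cmean n f g : (forall x, cmean Q (q n) f x = g x) ->
  expect n f = expect n g.
Proof.
move=> fg; rewrite /expect -(mean_cmean Q_gt0 f (q_dvdQ n) (@weight_periodic n)).
by apply: eq_mean => x; rewrite fg.
Qed.

Lemma ler_expect n f g : (forall x, f x <= g x) -> expect n f <= expect n g.
Proof. by move=> fg; apply: ler_mean => // x; rewrite ler_wpM2l ?weight_ge0. Qed.

Lemma expectZ n c f : expect n (fun x => c * f x) = c * expect n f.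
Proof. by rewrite /expect -meanZ; apply: eq_mean => x; rewrite mulrCA. Qed.

Lemma expect_sum (I : Type) (r : seq I) (p : pred I) n (F : I -> nat -> R) :
  expect n (fun x => \sum_(i <- r | p i) F i x)
  = \sum_(i <- r | p i) expect n (F i).
Proof. by rewrite -mean_sum; apply: eq_mean => x; rewrite mulr_sumr. Qed.

(** The conditional mean of [distortion n] given the residue mod [q n] is [(1 - alpha * (excess /
    alpha)) / (1 - excess) = 1], so step [n] preserves the mass of every class mod [q n]. *)
Lemma expectS_periodic n f : periodic (q n) f -> expect n.+1 f = expect n f.
Proof.
move=> fn; transitivity (expect n (fun x => distortion n x * f x)).
  by apply: eq_mean => x; rewrite weightS mulrA.
apply: expect_cmean => x.
pose s := excess n x; pose t := excess n x / alpha n x.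
rewrite (@eq_cmean _ _ _ _ (fun y => f x / (1 - s) + - (f x * t / (1 - s)) * b
  n y)).
  rewrite cmean_affine // -/(alpha n x).
  have s0 : 1 - s != 0 by rewrite gt_eqF // subr1_excess_gt0.
  transitivity (f x * (1 - alpha n x * t) / (1 - s)); first by field.
  by rewrite alpha_excess mulfK.
move=> y yx; rewrite /distortion (fn _ _ yx) (excess_periodic yx).
by rewrite (alpha_periodic yx) -/s -/t; ring.
Qed.

Lemma expect_periodic m n f : (m <= n)%N -> periodic (q m) f ->
  expect n f = expect m f.
Proof.
move=> + fm; elim: n => [|n IHn]; first by rewrite leqn0 => /eqP ->.
rewrite leq_eqVlt => /predU1P [-> //|]; rewrite ltnS => mn.
rewrite expectS_periodic ?IHn //.
exact: periodic_dvd (q_dvd mn) fm.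
Qed.

Lemma expect1 n : expect n (fun=> 1) = 1.
Proof.
rewrite (@expect_periodic 0) // /expect -[RHS](mean1 R Q_gt0).
by apply: eq_mean => x; rewrite /weight big_ord0 mulr1.
Qed.

Lemma expect_alpha n : expect n (alpha n) = expect n (b n).
Proof. by apply/esym/expect_cmean. Qed.

Lemma expectS_B n :
  expect n.+1 (b n)
  = expect n (fun x => (alpha n x - excess n x) / (1 - excess n x)).
Proof.
transitivity (expect n (fun x => distortion n x * b n x)).
  by apply: eq_mean => x; rewrite weightS mulrA.
apply: expect_cmean => x.
pose s := excess n x; pose t := excess n x / alpha n x.
(* Within one class mod [q n] the distortion is constant on [B n], and off [B n] the integrand
   vanishes. *)
rewrite (@eq_cmean _ _ _ _ (fun y => 0 + ((1 - t) / (1 - s)) * b n y)).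
  rewrite cmean_affine // -/(alpha n x) add0r.
  transitivity ((alpha n x - alpha n x * t) / (1 - s)); first by ring.
  by rewrite alpha_excess.
move=> y yx; rewrite /distortion (excess_periodic yx).
by rewrite (alpha_periodic yx) -/s -/t; case: (B n y) => /=; ring.
Qed.

Lemma expectS_B_delta0 n : delta n = 0 -> expect n.+1 (b n) = expect n (b n).
Proof.
by move=> d0; apply: eq_mean => x; rewrite weightS distortion_delta0 ?mulr1.
Qed.

Lemma expectS_B_le n : 0 < delta n ->
  expect n.+1 (b n) <= (2 * delta n)^-1 * expect n (fun x => alpha n x ^+ 2).
Proof.
move=> d0; rewrite expectS_B -expectZ; apply: ler_expect => x.
have s0 := subr1_excess_gt0 n x; have a0 := alpha_ge0 n x.
have d1 := delta_le n.
rewrite ler_pdivrMr // -mulrA ler_pdivlMl ?mulr_gt0 //.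
move: s0; rewrite /excess; case: (ltP (alpha n x)) => ad s0.
  by rewrite subrr mulr0 mulr_ge0 ?sqr_ge0 // ltW.
(* [(alpha - 2 delta)^2 >= 0] and [1 - delta >= 1/2] *)
have := sqr_ge0 (alpha n x - 2 * delta n).
have : 0 <= (2^-1 - delta n) * alpha n x ^+ 2.
  by rewrite mulr_ge0 ?sqr_ge0 // subr_ge0.
by nra.
Qed.

(* On the uncovered set the density of the distorted measure is at most
   exp (2 sum alpha); the lower bound follows from the tangent line
   e^-y >= e^-c (1 + c - y) at c = 4 C. *)
Lemma uncovered_mean_ge N (C : R) : 0 <= C ->
  \sum_(n < N) expect n.+1 (b n) <= 2^-1 ->
  \sum_(n < N) expect n (b n) <= C ->
  expR (- (4 * C)) / 2
  <= mean Q (fun x => [forall n : 'I_N, ~~ B n x]%:R).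
Proof.
move=> C0 small sumC.
pose u x : R := [forall n : 'I_N, ~~ B n x]%:R.
pose A x := \sum_(n < N) alpha n x.
pose c := 4 * C.
have A0 x : 0 <= A x by apply: sumr_ge0 => n _; exact: alpha_ge0.
(* At an uncovered point each distortion factor is [1 / (1 - excess)], which is at most
   [exp (2 alpha)]. *)
have weight_u x : u x * (weight N x * expR (- (2 * A x))) <= u x.
  rewrite /u; case: forallP => [nB|]; rewrite ?mul0r // !mul1r.
  rewrite mulr_sumr -sumrN expR_sum -big_split /=.
  apply: prodr_ile1 => n _; rewrite mulr_ge0 ?distortion_ge0 ?expR_ge0 //=.
  rewrite /distortion (negbTE (nB n)) mul0r subr0 mul1r.
  rewrite mulrC ler_pdivrMr ?subr1_excess_gt0 // mul1r.
  apply: (@le_trans _ _ (expR (- (2 * excess n x)))).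
    by rewrite ler_expR lerN2 ler_pM2l // excess_le_alpha.
  (* [e^{-2s} <= 1/(1+2s) <= 1-s] for [0 <= s <= 1/2] *)
  have s0 := excess_ge0 n x.
  rewrite expRN invf_ple ?posrE ?expR_gt0 ?subr1_excess_gt0 //.
  apply: le_trans (expR_ge1Dx _).
  rewrite -[leLHS]mul1r ler_pdivrMr ?subr1_excess_gt0 //.
  have := excess_le_delta n x; have := delta_le n; nra.
have u_ge x : 1 - \sum_(n < N) b n x <= u x.
  rewrite /u; case: forallP => [_|nB].
    by rewrite gerBl sumr_ge0.
  have [n /negPn Bn] : exists n : 'I_N, ~~ ~~ B n x.
    by apply/existsP; rewrite -negb_forall; apply/negP => /forallP.
  by rewrite subr_le0 (bigD1 n) //= Bn lerDl sumr_ge0.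
(* Steps after [n] preserve the masses of classes mod [q n.+1], hence that of [B n]. *)
have EB n : (n < N)%N -> expect N (b n) = expect n.+1 (b n).
  by move=> nN; apply: expect_periodic => // x y xy; rewrite (B_periodic xy).
have Eu : 2^-1 <= expect N u.
  apply: le_trans (ler_expect N u_ge).
  have -> : expect N (fun x => 1 - \sum_(n < N) b n x)
            = 1 - \sum_(n < N) expect N (b n).
    rewrite -expect_sum -mulN1r -expectZ -[X in _ = X + _](expect1 N).
    by rewrite /expect -meanD; apply: eq_mean => x; ring.
  under eq_bigr => n _ do rewrite EB //.
  by move: small; lra.
have EA : expect N A <= C.
  rewrite expect_sum; apply: le_trans sumC; apply: ler_sum => n _.
  rewrite -expect_alpha (@expect_periodic n) // 1?ltnW //.
  exact: alpha_periodic.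
apply: le_trans (_ : mean Q (fun x => u x * (weight N x * expR (- (2 * A x))))
  <= _);
  last exact: ler_mean.
(* Where [u x = 1] this is the tangent line; where [u x = 0] the left side is nonpositive since
   [A x >= 0]. *)
have tangent x : expR (- c) * ((1 + c) * u x - 2 * A x)
    <= u x * expR (- (2 * A x)).
  rewrite /u; case: forallP => _.
    have -> : - (2 * A x) = - c + (c - 2 * A x) by ring.
    rewrite mul1r mulr1 expRD ler_pM2l ?expR_gt0 //; apply: le_trans (expR_ge1Dx _).
    lra.
  rewrite mul0r mulr0 sub0r pmulr_rle0 ?expR_gt0 // oppr_le0 mulr_ge0 //.
apply: (@le_trans _ _ (expect N (fun x => expR (- c) * ((1 + c) * u x - 2 * A x)))).
  rewrite expectZ ler_pM2l ?expR_gt0 //.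
  (* The expectation is at least [(1 + c) / 2 - 2 * C], which equals 1/2 for [c = 4 * C]. *)
  have -> : expect N (fun x => (1 + c) * u x - 2 * A x)
            = (1 + c) * expect N u + (- 2) * expect N A.
    rewrite -!expectZ /expect -meanD.
    by apply: eq_mean => x; ring.
  by rewrite /c; nra.
rewrite /expect; apply: ler_mean => // x.
by rewrite [leRHS]mulrCA ler_wpM2l ?weight_ge0.
Qed.

End Distortion.

(** * Mertens' estimates *)

Section ChebyshevBound.
Local Open Scope nat_scope.

Lemma coprime_prod_prime_pow (m n : nat) (e : nat -> nat) : prime n ->
  coprime (\prod_(m <= p < n | prime p) p ^ e p) n.
Proof.
move=> pn; rewrite big_nat_cond.
apply: (big_ind (fun x => coprime x n)) => [|x y cx cy|p].
- exact: coprime1n.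
- by rewrite coprimeMl cx.
move=> /andP [/andP [_ ltpn] pp]; rewrite coprimeXl //.
by rewrite prime_coprime // dvdn_prime2 // (ltn_eqF ltpn).
Qed.

Lemma prod_prime_pow_dvd (X m n : nat) (e : nat -> nat) :
  (forall p, prime p -> m <= p < n -> p ^ e p %| X) ->
  \prod_(m <= p < n | prime p) p ^ e p %| X.
Proof.
elim: n => [|n IHn] eX; first by rewrite big_geq ?dvd1n.
have [nm|mn] := ltnP n m; first by rewrite big_geq ?dvd1n.
rewrite big_mkcond big_nat_recr //= -big_mkcond.
have IH : \prod_(m <= p < n | prime p) p ^ e p %| X.
  by apply: IHn => p pp /andP [mp pn]; apply: eX; rewrite // mp ltnW.
case: ifP => [pn|]; last by rewrite muln1.
rewrite Gauss_dvd ?coprimeXr ?coprime_prod_prime_pow // IH eX //.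
by rewrite mn ltnSn.
Qed.

Lemma prime_dvd_fact (p n : nat) : prime p -> (p %| n`!) = (p <= n).
Proof.
move=> pp; elim: n => [|n IHn]; first by rewrite dvdn1 leqn0; case: p pp => [|[]].
rewrite factS Euclid_dvdM // IHn; apply/orP/idP => [[/dvdn_leq->|]|] //;
  first exact: leqW.
by rewrite leq_eqVlt => /predU1P [->|]; [left | right].
Qed.

(** The two equal middle coefficients of [(1 + 1)^(2m+1)] sum to at most [2 * 4^m]. *)
Lemma bin_odd_le (m : nat) : 'C(m.*2.+1, m) <= 4 ^ m.
Proof.
rewrite -(leq_pmul2l (isT : 0 < 2)).
have -> : 2 * 4 ^ m = (1 + 1) ^ m.*2.+1.
  by rewrite addn1 expnS -mul2n expnM.
rewrite expnDn; under eq_bigr do rewrite !exp1n !muln1.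
have mS : m < m.*2.+2 by lia.
have mS' : m.+1 < m.*2.+2 by lia.
rewrite (bigD1 (Ordinal mS)) //= (bigD1 (Ordinal mS')) /=; last first.
  by rewrite -val_eqE /= gtn_eqF.
have -> : 'C(m.*2.+1, m.+1) = 'C(m.*2.+1, m).
  by rewrite -[in RHS]bin_sub; [congr 'C(_, _); lia | lia].
by rewrite addnA mul2n -addnn leq_addr.
Qed.

(** Erdős's induction: for [n = 2m+1], the primes in [[m+2, 2m+1]] divide the binomial coefficient
    [C(2m+1, m)], and induction handles those up to [m+1]; an even [n > 2] adds no prime. *)
Lemma primorial_le (n : nat) : \prod_(0 <= p < n.+1 | prime p) p <= 4 ^ n.
Proof.
elim/ltn_ind: n => n IHn.
case: n IHn => [|[|[|n]]] IHn; try by rewrite unlock.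
have := odd_double_half n.+3; move: (n.+3./2) => m.
case: (odd n.+3) => mn; rewrite -mn.
- rewrite add1n; have m0 : 0 < m by lia.
  rewrite (big_cat_nat (n := m.+2)) //=; last by lia.
  rewrite [4 ^ _](_ : _ = 4 ^ m.+1 * 4 ^ m); last first.
    by rewrite -expnD; congr (_ ^ _); lia.
  apply: leq_mul; first by apply: IHn; lia.
  apply: leq_trans (bin_odd_le m); apply: dvdn_leq.
    by rewrite bin_gt0; lia.
  have := @prod_prime_pow_dvd 'C(m.*2.+1, m) m.+2 m.*2.+2 (fun=> 1).
  under eq_bigr do rewrite expn1.
  apply=> p pp /andP [mp pm]; rewrite expn1.
  have : p %| m.*2.+1`! by rewrite dvdn_fact // prime_gt0 //; lia.
  rewrite -(@bin_fact m.*2.+1 m); last by lia.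
  rewrite !Euclid_dvdM // !prime_dvd_fact //.
  by case/or3P => //; lia.
- rewrite add0n big_mkcond big_nat_recr //= -big_mkcond.
  have /negbTE -> : ~~ prime m.*2.
    by apply/negP => /even_prime; rewrite odd_double; case=> //; lia.
  rewrite muln1 (mn : m.*2 = n.+3).
  by apply: leq_trans (IHn n.+2 _) _ => //; rewrite leq_pexp2l.
Qed.

End ChebyshevBound.

(** * Partial summation over primes *)

Section MertensBounds.
Variable R : realType.
Implicit Types (e c s x : R) (n N : nat).

Lemma ln_prod (I : Type) (r : seq I) (P : pred I) (F : I -> nat) :
  (forall i, P i -> (0 < F i)%N) ->
  ln ((\prod_(i <- r | P i) F i)%:R : R) = \sum_(i <- r | P i) ln (F i)%:R.
Proof.
move=> F0; elim: r => [|i r IHr]; first by rewrite !big_nil ln1.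
rewrite !big_cons; case: ifP => // Pi; rewrite natrM lnM ?IHr // posrE ltr0n ?F0 //.
by rewrite prodn_cond_gt0.
Qed.

Lemma ler_ln_nat (m n : nat) : (0 < m)%N -> (m <= n)%N ->
  ln (m%:R : R) <= ln n%:R.
Proof.
move=> m0 mn; rewrite ler_ln ?posrE ?ltr0n ?ler_nat //.
exact: leq_trans mn.
Qed.

Lemma ln_nat_ge0 n : 0 <= ln (n%:R : R).
Proof. by case: n => [|n]; [rewrite ln0 | rewrite ln_ge0 // ler1n]. Qed.

Lemma ln_nat_gt0 n : (1 < n)%N -> 0 < ln (n%:R : R).
Proof. by move=> n1; rewrite ln_gt0 // ltr1n. Qed.

Lemma chebyshev_theta_le n :
  \sum_(0 <= p < n.+1 | prime p) ln (p%:R : R) <= n%:R * ln 4.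
Proof.
rewrite -ln_prod => [|p]; last exact: prime_gt0.
rewrite mulr_natl -lnXn // -natrX; apply: ler_ln_nat (primorial_le n).
by rewrite prodn_cond_gt0 // => p; exact: prime_gt0.
Qed.

(** Keeping only the first term of Legendre's formula, the product of [p ^ (n %/ p)] divides [n!],
    which is at most [n ^ n]. Rounding in [n %/ p] costs at most [ln p] per prime, which Chebyshev's
    bound absorbs. *)
Lemma mertens_first n : (0 < n)%N ->
  \sum_(0 <= p < n.+1 | prime p) ln p%:R / p%:R <= ln n%:R + ln (4 : R).
Proof.
move=> n0; have nR : 0 < n%:R :> R by rewrite ltr0n.
pose N := (\prod_(0 <= p < n.+1 | prime p) p ^ (n %/ p))%N.
have NX : (N <= n ^ n)%N.
  apply: leq_trans (_ : n`! <= _)%N.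
    apply: dvdn_leq (fact_gt0 n) _; apply: prod_prime_pow_dvd => p pp _.
    rewrite pfactor_dvdn ?fact_gt0 // logn_fact //.
    by rewrite big_ltn // expn1 leq_addr.
  rewrite fact_prod -[X in (_ ^ X)%N](subn0 n) -subSS -prod_nat_const_nat.
  by rewrite big_nat [leqRHS]big_nat; apply: leq_prod => i /andP [].
have N0 : (0 < N)%N.
  by rewrite prodn_cond_gt0 // => p pp; rewrite expn_gt0 prime_gt0.
have : ln (N%:R : R) <= n%:R * ln n%:R.
  by rewrite mulr_natl -lnXn // -natrX; exact: ler_ln_nat.
rewrite ln_prod => [|p pp]; last by rewrite expn_gt0 prime_gt0.
have floor_ge (p : nat) : prime p ->
    n%:R * (ln p%:R / p%:R) - ln p%:R <= ln ((p ^ (n %/ p))%N%:R : R).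
  move=> pp; have p0 : 0 < p%:R :> R by rewrite ltr0n prime_gt0.
  rewrite natrX lnXn // -[leRHS]mulr_natl.
  have -> : n%:R * (ln p%:R / p%:R) - ln (p%:R : R) = (n%:R / p%:R - 1) * ln p%:R.
    by field; rewrite gt_eqF.
  rewrite ler_wpM2r ?ln_nat_ge0 // lerBlDr ler_pdivrMr // natr1 -natrM ler_nat.
  by rewrite ltnW // ltn_ceil // prime_gt0.
move/(le_trans (ler_sum _ (fun p pp => floor_ge p pp))).
rewrite sumrB -mulr_sumr => H.
rewrite -(ler_pM2l nR) mulrDr.
by have := chebyshev_theta_le n; lra.
Qed.

Lemma abel_sum_le (a f G : nat -> R) :
  (forall n, 0 <= f n) -> (forall n, f n.+1 <= f n) ->
  (forall n, \sum_(k < n.+1) a k <= G n) -> forall n,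
  \sum_(k < n.+1) a k * f k
  <= G 0%N * f 0%N + \sum_(k < n) (G k.+1 - G k) * f k.+1.
Proof.
move=> f0 fS aG n; rewrite -subr_ge0.
(* With [A] the partial sums of [a], the right side minus the left is [(G n - A n) f n] plus the sum
   of [(G k - A k) (f k - f k.+1)]; retaining the boundary term makes the induction close. *)
suff : (G n - \sum_(k < n.+1) a k) * f n
   <= G 0%N * f 0%N + \sum_(k < n) (G k.+1 - G k) * f k.+1
      - \sum_(k < n.+1) a k * f k.
  by apply: le_trans; rewrite mulr_ge0 // subr_ge0.
elim: n => [|n IHn]; first by rewrite !big_ord_recl !big_ord0; lra.
rewrite !(big_ord_recr n.+1) [\sum_(k < n.+1) (G _ - _) * _]big_ord_recr /=.
have := aG n; have := fS n; move: IHn; nra.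
Qed.

Lemma sum_primes_shift (F : nat -> R) n :
  \sum_(0 <= p < n.+2 | prime p) F p
  = \sum_(k < n) (if prime k.+2 then F k.+2 else 0).
Proof.
rewrite big_mkcond big_mkord !big_ord_recl /= !add0r.
by [].
Qed.

(** Partial summation against Mertens' first estimate. The index is [p - 2], so that sequences built
    from [1 / ln p] start at a positive logarithm. *)
Lemma sum_primes_abel_le (f : nat -> R) :
  (forall n, 0 <= f n) -> (forall n, f n.+1 <= f n) -> forall n,
  \sum_(0 <= p < n.+3 | prime p) ln p%:R / p%:R * f (p - 2)%N
  <= (ln 2 + ln 4) * f 0%N
     + \sum_(k < n) (ln k.+3%:R - ln k.+2%:R) * f k.+1.
Proof.
move=> f0 fS n; rewrite sum_primes_shift.
pose a k : R := if prime k.+2 then ln k.+2%:R / k.+2%:R else 0.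
have := @abel_sum_le a f (fun k => ln k.+2%:R + ln 4) f0 fS _ n.
have aG k : \sum_(i < k.+1) a i <= ln k.+2%:R + ln 4.
  by rewrite -(sum_primes_shift (fun p => ln p%:R / p%:R)); exact: mertens_first.
move/(_ aG).
have -> : \sum_(k < n) (ln k.+3%:R + ln 4 - (ln k.+2%:R + ln 4)) * f k.+1
   = \sum_(k < n) (ln k.+3%:R - ln (k.+2%:R : R)) * f k.+1.
  by apply: eq_bigr => k _; congr (_ * _); ring.
apply: le_trans; apply: ler_sum => k _; rewrite /a subn2 /=.
by case: ifP; rewrite ?mul0r.
Qed.

(** Partial summation with weight [1 / ln p]: by [ln y <= y - 1], the increments of [ln] divided by
    the later value are at most those of [ln ln], and they telescope. *)
Lemma sum_inv_primes_le : exists c, forall n, (1 < n)%N ->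
  \sum_(0 <= p < n.+1 | prime p) (p%:R)^-1 <= ln (ln n%:R) + c.
Proof.
pose f k : R := (ln k.+2%:R)^-1.
exists ((ln 2 + ln 4) * f 0%N - ln (ln 2)); case=> [|[|n]] // _.
have L0 k : 0 < ln (k.+2%:R : R) by exact: ln_nat_gt0.
have f0 k : 0 <= f k by rewrite invr_ge0 ltW.
have fS k : f k.+1 <= f k.
  by rewrite lef_pV2 ?posrE ?L0 //; apply: ler_ln_nat.
have := sum_primes_abel_le f0 fS n.
have -> : \sum_(0 <= p < n.+3 | prime p) ln p%:R / p%:R * f (p - 2)%N
   = \sum_(0 <= p < n.+3 | prime p) (p%:R)^-1 :> R.
  apply: eq_bigr => -[|[|p]] // pp; rewrite /f subn2 /=.
  have := L0 p; move: (ln _) => l l0; rewrite mulrAC mulfV ?mul1r //.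
  exact: lt0r_neq0.
move/le_trans; apply.
suff : \sum_(k < n) (ln k.+3%:R - ln k.+2%:R) * f k.+1
   <= ln (ln n.+2%:R) - ln (ln 2) by lra.
elim: n => [|n IHn]; first by rewrite big_ord0 subrr.
rewrite big_ord_recr /=.
suff : (ln n.+3%:R - ln n.+2%:R) * f n.+1
    <= ln (ln n.+3%:R) - ln (ln (n.+2%:R : R)) by move: IHn; lra.
have := L0 n; have := L0 n.+1; rewrite /f.
move: (ln n.+2%:R) (ln n.+3%:R) => x y y0 x0.
have := @le_ln1Dx R (x / y - 1).
rewrite subrKC ln_div ?posrE // mulrBl divff ?gt_eqF // => H.
suff : ln x - ln y <= x / y - 1 by lra.
by apply: H; rewrite ltrBrDl subrr divr_gt0.
Qed.

(** Partial summation with weight [(ln p)^-(1+e)]: the increments are at most those of [- L^-e / e],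
    so the sum telescopes to a bounded quantity. *)
Lemma sum_inv_primes_ln_powR_le e : 0 < e -> exists c, forall n,
  \sum_(0 <= p < n | prime p) (p%:R * ln p%:R `^ e)^-1 <= c.
Proof.
move=> e0; pose L k : R := ln k.+2%:R.
have L0 k : 0 < L k by exact: ln_nat_gt0.
have LS k : L k <= L k.+1 by exact: ler_ln_nat.
pose f k : R := L k `^ (- (1 + e)).
pose c := (ln 2 + ln 4) * f 0%N + e^-1 * L 0%N `^ (- e).
have LD k : L k `^ (1 + e) = L k * L k `^ e.
  by rewrite powRD ?powRr1 ?ltW //; apply/implyP => _; rewrite gt_eqF.
exists c => n; have f0 k : 0 <= f k by exact: powR_ge0.
have fS k : f k.+1 <= f k.
  rewrite /f !powRN lef_pV2 ?posrE ?powR_gt0 //.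
  by apply: ge0_ler_powR (LS k); rewrite ?nnegrE ?(ltW (L0 _)) //; lra.
apply: (@le_trans _ _ (\sum_(0 <= p < n.+3 | prime p) (p%:R * ln p%:R `^ e)^-1)).
  rewrite (big_cat_nat (n := n) (p := n.+3)) //=; last by lia.
  by rewrite lerDl sumr_ge0 // => p _; rewrite invr_ge0 mulr_ge0 ?powR_ge0.
have := sum_primes_abel_le f0 fS n.
have -> : \sum_(0 <= p < n.+3 | prime p) ln p%:R / p%:R * f (p - 2)%N
   = \sum_(0 <= p < n.+3 | prime p) (p%:R * ln p%:R `^ e)^-1 :> R.
  apply: eq_bigr => -[|[|p]] // pp; rewrite /f subn2 /= -/(L p).
  have p0 : p.+2%:R != 0 :> R by rewrite pnatr_eq0.
  rewrite powRN LD; move: (p.+2%:R) p0 => P P0; field.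
  by rewrite P0 !gt_eqF ?powR_gt0.
move/le_trans; apply; rewrite lerD2l.
suff : \sum_(k < n) (L k.+1 - L k) * f k.+1
   <= e^-1 * (L 0%N `^ (- e) - L n `^ (- e)).
  move/le_trans; apply; rewrite ler_pM2l ?invr_gt0 // gerBl.
  exact: powR_ge0.
elim: n => [|n IHn]; first by rewrite big_ord0 subrr mulr0.
rewrite big_ord_recr /=.
suff : (L n.+1 - L n) * f n.+1 <= e^-1 * (L n `^ (- e) - L n.+1 `^ (- e)).
  by move: IHn; rewrite !mulrBr; lra.
(* with [r = L n / L n.+1]: [r^-e >= 1 - e ln r >= 1 + e (1 - r)] *)
pose r := L n / L n.+1.
have r0 : 0 < r by rewrite divr_gt0.
have lnr : ln r <= r - 1.
  have := @le_ln1Dx R (r - 1); rewrite subrKC; apply.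
  by rewrite ltrBrDl subrr.
have re : 1 + e * (1 - r) <= r `^ (- e).
  rewrite /powR gt_eqF //; apply: le_trans (expR_ge1Dx _); nra.
have yE : L n = r * L n.+1 by rewrite divfK // gt_eqF.
rewrite ler_pdivlMl // /f powRN LD yE powRM ?(ltW r0) ?(ltW (L0 _)) //.
rewrite !(powRN (L _)); move: (L0 n.+1) (powR_gt0 e (L0 n.+1)).
move: (L n.+1) (L n.+1 `^ e) => y Z y0 Z0.
have -> : e * ((y - r * y) * (y * Z)^-1) = (e * (1 - r)) * Z^-1.
  by field; rewrite !gt_eqF.
suff : 0 <= (r `^ (- e) - 1 - e * (1 - r)) * Z^-1 by lra.
by rewrite mulr_ge0 ?invr_ge0 ?(ltW Z0) //; lra.
Qed.

(** The inequality [ln y < y] at [y = n^(1/s)] gives [ln n <= s * n^(1/s)]; raising it to the power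
    [s] produces the constant [s^s]. *)
Lemma powR_ln_le s : 0 < s -> forall n, (0 < n)%N ->
  ln n%:R `^ s <= s `^ s * n%:R.
Proof.
move=> s0 n n0; have nR : 0 < n%:R :> R by rewrite ltr0n.
have : ln n%:R <= s * n%:R `^ s^-1.
  rewrite -ler_pdivrMl // mulrC -[leLHS]mulrC -ln_powR.
  by apply: ltW; apply: ln_sublinear; rewrite powR_gt0.
move/(ge0_ler_powR (ltW s0)); rewrite !nnegrE ln_nat_ge0.
rewrite mulr_ge0 ?powR_ge0 ?(ltW s0) // => /(_ isT isT) /=.
by rewrite powRM ?powR_ge0 ?(ltW s0) // -powRrM mulVf ?gt_eqF // powRr1 ?(ltW nR).
Qed.

End MertensBounds.

(** * Sums over divisors *)

Section DivisorSums.
Local Open Scope nat_scope.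
Implicit Types (a b d m n p u v : nat).

Lemma dvdn_coprime_factor a b d : coprime a b -> d %| a * b ->
  d = gcdn d a * gcdn d b.
Proof.
move=> cab dab; apply/eqP; rewrite eqn_dvd; apply/andP; split; last first.
  rewrite Gauss_dvd ?dvdn_gcdl //.
  exact: coprime_dvdl (dvdn_gcdr _ _) (coprime_dvdr (dvdn_gcdr _ _) cab).
by rewrite muln_gcdl !muln_gcdr !dvdn_gcd dvdn_mull // dvdn_mulr // dvdn_mull.
Qed.

Lemma perm_divisorsM a b : 0 < a -> 0 < b -> coprime a b ->
  perm_eq (divisors (a * b)) [seq u * v | u <- divisors a, v <- divisors b].
Proof.
move=> a0 b0 cab; have ab0 : 0 < a * b by rewrite muln_gt0 a0.
have cuv u v : u %| a -> v %| b -> gcdn (u * v) a = u.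
  move=> ua vb; rewrite gcdnC Gauss_gcdl ?(coprime_dvdr vb) //.
  exact/gcdn_idPr.
apply: uniq_perm; first exact: divisors_uniq.
  apply: allpairs_uniq; rewrite ?divisors_uniq // => -[u v] [u' v'].
  move=> /allpairsP [[u1 v1] /= [+ + [-> ->]]].
  move=> + + /allpairsP [[u2 v2] /= [+ + [-> ->]]].
  rewrite -!dvdn_divisors // => u1a v1b u2a v2b /= E.
  have Eu : u1 = u2 by rewrite -(cuv u1 v1) // E cuv.
  have u0 : 0 < u2 := dvdn_gt0 a0 u2a.
  by congr (_, _) => //; apply/eqP; rewrite -(eqn_pmul2l u0) -{1}Eu E.
move=> d; rewrite -dvdn_divisors //; apply/idP/allpairsP.
  move=> dab; exists (gcdn d a, gcdn d b); split => /=.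
  - by rewrite -dvdn_divisors ?dvdn_gcdr.
  - by rewrite -dvdn_divisors ?dvdn_gcdr.
  - exact: dvdn_coprime_factor.
by case=> -[u v] /= []; rewrite -!dvdn_divisors // => ua vb ->; apply: dvdn_mul.
Qed.

Lemma perm_divisors_pow p e : prime p ->
  perm_eq (divisors (p ^ e)) [seq p ^ t | t <- iota 0 e.+1].
Proof.
move=> pp; have pe0 : 0 < p ^ e by rewrite expn_gt0 prime_gt0.
apply: uniq_perm; first exact: divisors_uniq.
  by rewrite map_inj_uniq ?iota_uniq //; apply: expnI; exact: prime_gt1.
move=> d; rewrite -dvdn_divisors //; apply/(dvdn_pfactor _ _ pp)/mapP.
  by case=> m me ->; exists m; rewrite // mem_iota add0n.
by case=> m; rewrite mem_iota add0n => me ->; exists m.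
Qed.

Lemma lcmnM_coprime u1 u2 v1 v2 :
  coprime u1 v1 -> coprime u1 v2 -> coprime u2 v1 -> coprime u2 v2 ->
  lcmn (u1 * v1) (u2 * v2) = lcmn u1 u2 * lcmn v1 v2.
Proof.
move=> c11 c12 c21 c22.
have cl : coprime (lcmn u1 u2) (lcmn v1 v2).
  have dl x y : lcmn x y %| x * y by rewrite dvdn_lcm dvdn_mulr ?dvdn_mull.
  apply: coprime_dvdl (dl _ _) (coprime_dvdr (dl _ _) _).
  by rewrite coprimeMl !coprimeMr c11 c12 c21 c22.
have E m : (lcmn (u1 * v1) (u2 * v2) %| m) = (lcmn u1 u2 * lcmn v1 v2 %| m).
  by rewrite Gauss_dvd // !dvdn_lcm !Gauss_dvd // andbACA.
by apply/eqP; rewrite eqn_dvd E dvdnn -E dvdnn.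
Qed.

Lemma lcmn_pow p s t : 0 < p -> lcmn (p ^ s) (p ^ t) = p ^ maxn s t.
Proof.
move=> p0; have [st|/ltnW ts] := leqP s t.
  by apply/lcmn_idPr; rewrite dvdn_exp2l.
by apply/lcmn_idPl; rewrite dvdn_exp2l.
Qed.

Definition smooth_part Q n := \prod_(0 <= p < n | prime p) p ^ logn p Q.

(** At a non-prime [n] the exponent [logn n Q] is 0, so the steps of the method can run over all
    naturals, with [q] unchanged there. *)
Lemma smooth_partS Q n : smooth_part Q n.+1 = smooth_part Q n * n ^ logn n Q.
Proof.
rewrite /smooth_part big_mkcond big_nat_recr //= -big_mkcond; congr (_ * _).
by case: ifP => // /negbT np; rewrite lognE (negbTE np).
Qed.

Lemma smooth_part_dvd Q n : 0 < Q -> smooth_part Q n %| Q.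
Proof.
move=> Q0; apply: prod_prime_pow_dvd => p pp _.
by rewrite pfactor_dvdn.
Qed.

Lemma smooth_part_gt0 Q n : 0 < smooth_part Q n.
Proof.
by rewrite prodn_cond_gt0 // => p pp; rewrite expn_gt0 prime_gt0.
Qed.

Lemma coprime_smooth_part Q n : prime n -> coprime (smooth_part Q n) n.
Proof. by move=> pn; exact: (@coprime_prod_prime_pow 0 n (logn^~ Q)). Qed.

Lemma pow_dvd_smooth_part Q n p : prime p -> p < n ->
  p ^ logn p Q %| smooth_part Q n.
Proof.
move=> pp; elim: n => // n IHn; rewrite ltnS leq_eqVlt smooth_partS.
by case/predU1P => [->|/IHn pn]; [rewrite dvdn_mull | rewrite dvdn_mulr].
Qed.

Lemma dvdn_smooth_part Q n d : 0 < Q -> d %| Q ->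
  (forall p, prime p -> p %| d -> p < n) -> d %| smooth_part Q n.
Proof.
move=> Q0 dQ dn; have d0 := dvdn_gt0 Q0 dQ.
apply/dvdn_partP => // p; rewrite mem_primes => /and3P [pp _ pd].
rewrite p_part; apply: dvdn_trans (pow_dvd_smooth_part Q pp (dn p pp pd)).
by rewrite dvdn_exp2l // dvdn_leq_log.
Qed.

End DivisorSums.

Lemma sum_divisorsM (R : nmodType) (a b : nat) (F : nat -> R) :
  (0 < a)%N -> (0 < b)%N -> coprime a b ->
  \sum_(d <- divisors (a * b)) F d
  = \sum_(u <- divisors a) \sum_(v <- divisors b) F (u * v)%N.
Proof.
move=> a0 b0 cab; rewrite (perm_big _ (perm_divisorsM a0 b0 cab)) /=.
by rewrite big_allpairs_dep.
Qed.

Lemma sum_divisors_pow (R : nmodType) (p e : nat) (F : nat -> R) : prime p ->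
  \sum_(d <- divisors (p ^ e)) F d = \sum_(t < e.+1) F (p ^ t)%N.
Proof.
move=> pp; rewrite (perm_big _ (perm_divisors_pow e pp)) big_map.
by rewrite -[iota _ _]/(index_iota 0 e.+1) big_mkord.
Qed.

Lemma sum_divisors_smoothS (R : nmodType) (Q n : nat) (F : nat -> R) : prime n ->
  \sum_(d <- divisors (smooth_part Q n.+1)) F d
  = \sum_(u <- divisors (smooth_part Q n)) \sum_(t < (logn n Q).+1) F (u * n ^ t)%N.
Proof.
move=> pn; rewrite smooth_partS sum_divisorsM ?smooth_part_gt0 ?expn_gt0 ?prime_gt0
  ?coprimeXr ?coprime_smooth_part //.
by apply: eq_bigr => u _; rewrite sum_divisors_pow.
Qed.

(** An Euler product of truncated geometric series in [p^(-1/2)]. The bound depends on [n] but not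
    on [Q], as a choice of [M] before the moduli requires. *)
Lemma sum_smooth_inv_sqrt_le (R : rcfType) (Q n : nat) :
  \sum_(d <- divisors (smooth_part Q n)) (Num.sqrt (d%:R : R))^-1
  <= \prod_(0 <= p < n | prime p) (1 - (Num.sqrt p%:R)^-1)^-1.
Proof.
elim: n => [|n IHn].
  rewrite /smooth_part !big_geq // (_ : divisors 1 = [:: 1%N]) //.
  by rewrite big_seq1 sqrtr1 invr1.
rewrite [leRHS]big_mkcond big_nat_recr //= -big_mkcond.
have [pn|npn] := ifPn; last first.
  by rewrite smooth_partS lognE (negbTE npn) muln1 mulr1.
rewrite sum_divisors_smoothS //.
pose x : R := (Num.sqrt n%:R)^-1.
have x0 : 0 < x by rewrite invr_gt0 sqrtr_gt0 ltr0n prime_gt0.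
have x1 : x < 1.
  rewrite invf_lt1 ?sqrtr_gt0 ?ltr0n ?prime_gt0 // -[X in X < _]sqrtr1.
  by rewrite ltr_sqrt ?ltr0n ?prime_gt0 // ltr1n prime_gt1.
have geo e : \sum_(t < e) x ^+ t <= (1 - x)^-1.
  rewrite -[leRHS]mul1r ler_pdivlMr ?subr_gt0 // mulrC.
  by have := subrX1 x e; have := exprn_ge0 e (ltW x0); lra.
have sqrtX t : Num.sqrt ((n ^ t)%:R : R) = Num.sqrt n%:R ^+ t.
  elim: t => [|t IHt]; first by rewrite sqrtr1.
  by rewrite expnS natrM sqrtrM // IHt exprS.
rewrite (eq_bigr (fun u : nat => (Num.sqrt u%:R)^-1 * \sum_(t < (logn n Q).+1)
  x ^+ t));
  last first.
  move=> u _; rewrite mulr_sumr; apply: eq_bigr => t _.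
  by rewrite natrM sqrtrM // sqrtX invfM exprVn.
rewrite -mulr_suml; apply: ler_pM => //.
- by apply: sumr_ge0 => u _; rewrite invr_ge0 sqrtr_ge0.
- by apply: sumr_ge0 => t _; rewrite exprn_ge0 // ltW.
Qed.

(** The distinctness of the moduli enters here: a sum over progressions becomes a sum over
    divisors. *)
Lemma ler_sum_inj (R : numDomainType) (I : finType) (P : pred I) (d : I -> nat)
    (s : seq nat) (F : nat -> R) :
  injective d -> uniq s -> (forall m, m \in s -> 0 <= F m) ->
  (forall i, P i -> d i \in s) -> \sum_(i | P i) F (d i) <= \sum_(m <- s) F m.
Proof.
move=> dI us F0 ds; pose t := [seq d i | i <- enum P].
have -> : \sum_(i | P i) F (d i) = \sum_(m <- t) F m.
  by rewrite big_map big_enum.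
rewrite [leRHS](bigID (mem t)) /= -[X in X + _]big_filter.
have tP : perm_eq [seq m <- s | m \in t] t.
  apply: uniq_perm; rewrite ?filter_uniq ?map_inj_uniq ?enum_uniq // => m.
  rewrite mem_filter; apply: andb_idr => /mapP [i].
  by rewrite mem_enum => /ds + ->.
by rewrite (perm_big _ tP) lerDl big_seq_cond sumr_ge0 // => m /andP [/F0].
Qed.

Lemma modn_lcm (x y m n : nat) :
  (x == y %[mod lcmn m n]) = (x == y %[mod m]) && (x == y %[mod n]).
Proof.
wlog xy : x y / (y <= x)%N.
  by move=> H; case/orP: (leq_total x y) => /H // E;
    rewrite eq_sym E ![_ == x %[mod _]]eq_sym.
by rewrite !eqn_mod_dvd // dvdn_lcm.
Qed.

(** Chinese remainder theorem: a class mod [q] inside [r] mod [u] meets [r] mod [u * k] in one class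
    mod [q * k], a proportion [1 / k]; any other class misses it. *)
Lemma cmean_progression (R : realType) (Q q k u r x : nat) :
  (0 < Q)%N -> (q * k %| Q)%N -> (u %| q)%N -> coprime q k ->
  cmean Q q (fun y => (y == r %[mod u * k])%:R) x
  = (x == r %[mod u])%:R / k%:R :> R.
Proof.
move=> Q0 qkQ uq cqk.
have qQ : (q %| Q)%N by exact: dvdn_trans (dvdn_mulr _ (dvdnn _)) qkQ.
have q0 : q%:R != 0 :> R by rewrite pnatr_eq0 -lt0n (dvdn_gt0 Q0).
have k0 : k%:R != 0 :> R.
  by rewrite pnatr_eq0 -lt0n; move: (dvdn_gt0 Q0 qkQ); rewrite muln_gt0 => /andP [].
have cuk : coprime u k by exact: coprime_dvdl uq cqk.
have mod_u y z : y == z %[mod q] -> y == z %[mod u].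
  by move=> /eqP yz; apply/eqP; rewrite -(modn_dvdm y uq) yz modn_dvdm.
rewrite /cmean; case: (boolP (x == r %[mod u])) => xr /=; last first.
  rewrite big1 ?mulr0 ?mul0r // => y /mod_u /eqP yx.
  by rewrite chinese_remainder // yx (negbTE xr).
pose z := chinese q k x r.
have yz (y : 'I_Q) : (y == x %[mod q]) && (y == r %[mod u * k])
  = (y == z %[mod q * k]).
  rewrite !chinese_remainder // chinese_modl // chinese_modr //.
  case: (boolP (y == x %[mod q])) => //= /mod_u /eqP ->.
  by rewrite xr.
under eq_bigr do rewrite mulrb.
rewrite -big_mkcondr /=.
under eq_bigl do rewrite yz.
rewrite sum_residue_class // natrM; field.
by rewrite q0 k0 Q_neq0.
Qed.

(** * Euler products for sums over pairs of divisors *)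

Section LcmSums.
Variable R : realType.
Implicit Types (G h w : nat -> R) (Q n : nat).

(** It arises from squaring a sum over progressions, because a progression mod [u] and one mod [v]
    meet, if at all, in a single class mod [lcmn u v]. *)
Definition lcm_sum G m : R :=
  \sum_(u <- divisors m) \sum_(v <- divisors m) G (lcmn u v).

Lemma lcm_sum_smoothS G Q n :
  (forall a b, (0 < a)%N -> (0 < b)%N -> coprime a b -> G (a * b)%N = G a * G b) ->
  prime n ->
  lcm_sum G (smooth_part Q n.+1)
  = lcm_sum G (smooth_part Q n)
    * \sum_(s < (logn n Q).+1) \sum_(t < (logn n Q).+1) G (n ^ maxn s t)%N.
Proof.
move=> GM pn; rewrite /lcm_sum sum_divisors_smoothS // mulr_suml.
have n0 := prime_gt0 pn.
have q0 := smooth_part_gt0 Q n.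
have cop u t : u \in divisors (smooth_part Q n) -> coprime u (n ^ t).
  rewrite -dvdn_divisors // => uq; rewrite coprimeXr //.
  exact: coprime_dvdl uq (coprime_smooth_part Q pn).
apply: eq_big_seq => u uq; rewrite mulr_sumr; apply: eq_bigr => s _.
rewrite sum_divisors_smoothS // mulr_suml; apply: eq_big_seq => v vq.
rewrite mulr_sumr; apply: eq_bigr => t _.
have dq z : z \in divisors (smooth_part Q n) -> (0 < z)%N.
  by rewrite -dvdn_divisors // => /(dvdn_gt0 q0).
rewrite lcmnM_coprime ?cop // lcmn_pow // GM ?expn_gt0 ?n0 ?lcmn_gt0 ?dq //.
apply: coprime_dvdl (_ : lcmn u v %| u * v)%N _.
  by rewrite dvdn_lcm dvdn_mulr ?dvdn_mull.
by rewrite coprimeMl !cop.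
Qed.

(** Exactly [2 * e + 1] pairs of exponents up to [e] have maximum [e]. *)
Lemma max_sumS h e :
  \sum_(s < e.+1) \sum_(t < e.+1) h (maxn s t)
  = \sum_(s < e) \sum_(t < e) h (maxn s t) + (2 * e%:R + 1) * h e.
Proof.
rewrite big_ord_recr /=.
under eq_bigr => s _ do rewrite big_ord_recr /= (maxn_idPr (ltnW (ltn_ord s))).
rewrite big_split /= sumr_const card_ord -addrA; congr (_ + _).
rewrite (eq_bigr (fun=> h e)) => [|t _]; last first.
  by rewrite (maxn_idPl _) // -ltnS ltn_ord.
by rewrite sumr_const card_ord mulrSr -mulr_natl; ring.
Qed.

(** The main term [3 * x] counts the three pairs with maximum 1. The rest is at most
    [x^2 * (3 y + 2 y^2)] with [y = 1 / (1 - x) <= 2], whence 14. *)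
Lemma max_sum_geometric_le h e (w x : R) : 0 <= w -> 0 < x -> x <= 2^-1 ->
  h 0%N = 1 -> (forall t, (0 < t)%N -> h t = w * x ^+ t) ->
  \sum_(s < e.+1) \sum_(t < e.+1) h (maxn s t) <= 1 + w * (3 * x + 14 * x ^+ 2).
Proof.
move=> w0 x0 x2 h0 hS; have x1 : 0 < 1 - x by lra.
pose y := (1 - x)^-1; have y0 : 0 < y by rewrite invr_gt0.
have yx : y * (1 - x) = 1 by rewrite mulVf // gt_eqF.
(* the tail [\sum_(t > e) (2 t + 1) x^t] in closed form *)
have closed : \sum_(s < e.+1) \sum_(t < e.+1) h (maxn s t)
    + w * (x ^+ e.+1 * ((2 * e%:R + 3) * y + 2 * x * y ^+ 2))
    = 1 + w * (3 * x * y + 2 * x ^+ 2 * y ^+ 2).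
  elim: e => [|e IHe].
    by rewrite !big_ord_recl !big_ord0 maxnn h0 expr1; ring.
  rewrite max_sumS hS // -IHe -addrA; congr (_ + _).
  rewrite -natr1 [x ^+ e.+2]exprSr /y; field.
  by rewrite gt_eqF.
have tail0 : 0 <= w * (x ^+ e.+1 * ((2 * e%:R + 3) * y + 2 * x * y ^+ 2)).
  have ? := ltW x0; have ? := ltW y0; apply: mulr_ge0 => //.
  by apply: mulr_ge0; rewrite ?exprn_ge0 // addr_ge0 // !mulr_ge0 ?exprn_ge0 //
    addr_ge0 // mulr_ge0.
clearbody y; have y2 : y <= 2.
  have : 0 <= y * (2^-1 - x) by rewrite mulr_ge0 ?(ltW y0) // subr_ge0.
  by move: yx; lra.
have : 3 * x * y + 2 * x ^+ 2 * y ^+ 2 <= 3 * x + 14 * x ^+ 2.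
  have -> : 3 * x * y = 3 * x + 3 * x ^+ 2 * y by rewrite -{2}[x]mulr1 -yx; ring.
  have : 0 <= x ^+ 2 * (2 - y) by rewrite mulr_ge0 ?sqr_ge0 // subr_ge0.
  have : 0 <= x ^+ 2 * ((2 - y) * (2 + y)).
    by rewrite mulr_ge0 ?sqr_ge0 // mulr_ge0 ?subr_ge0 // addr_ge0 // ltW.
  lra.
move/(ler_wpM2l w0); move: closed tail0.
by move: (w * (x ^+ _ * _)) (\sum_(s < _) _) => T D; lra.
Qed.

Lemma lcm_sum_le (mu w : nat -> R) Q n :
  (forall a b, (0 < a)%N -> (0 < b)%N -> coprime a b -> mu (a * b)%N
    = mu a * mu b) ->
  mu 1%N = 1 -> (forall p, 0 <= w p) ->
  (forall p i, prime p -> (0 < i)%N -> mu (p ^ i)%N = 1 + w p) ->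
  lcm_sum (fun m => mu m / m%:R) (smooth_part Q n)
  <= \prod_(0 <= p < n | prime p)
       (1 + (1 + w p) * (3 * p%:R^-1 + 14 * p%:R^-1 ^+ 2)).
Proof.
move=> muM mu1 w0 muX; set G := fun m => _.
have GM a b : (0 < a)%N -> (0 < b)%N -> coprime a b -> G (a * b)%N = G a * G b.
  by move=> a0 b0 cab; rewrite /G muM // natrM invfM mulrACA.
elim: n => [|n IHn].
  rewrite /smooth_part !big_geq // /lcm_sum (_ : divisors 1 = [:: 1%N]) //.
  by rewrite !big_seq1 /G mu1 divr1.
rewrite [leRHS]big_mkcond big_nat_recr //= -big_mkcond.
have [pn|npn] := ifPn; last first.
  by rewrite smooth_partS lognE (negbTE npn) muln1 mulr1.
have n0 : 0 < n%:R :> R by rewrite ltr0n prime_gt0.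
rewrite lcm_sum_smoothS //.
have w1 := w0 n.
have geo : \sum_(s < (logn n Q).+1) \sum_(t < (logn n Q).+1) G (n ^ maxn s t)%N
    <= 1 + (1 + w n) * (3 * n%:R^-1 + 14 * n%:R^-1 ^+ 2).
  apply: (@max_sum_geometric_le (fun m => G (n ^ m)%N)).
  - by lra.
  - by rewrite invr_gt0.
  - by rewrite lef_pV2 ?posrE // (ler_nat _ 2) prime_gt1.
  - by rewrite /G expn0 mu1 divr1.
  - by move=> t t0; rewrite /G muX // natrX exprVn.
apply: le_trans (ler_wpM2r _ IHn) (ler_wpM2l _ geo).
  apply: sumr_ge0 => s _; apply: sumr_ge0 => t _; rewrite /G divr_ge0 //.
  have [->|m0] := posnP (maxn s t); first by rewrite mu1.
  by rewrite muX //; lra.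
apply: prodr_ge0 => p pp; have := w0 p => wp.
by rewrite addr_ge0 // mulr_ge0 ?addr_ge0 // mulr_ge0 // ?exprn_ge0 // invr_ge0.
Qed.

(** Each factor is at most [exp (3 / p + K * T p)]. Mertens turns the first terms into [(ln n)^3],
    and the sum of [T p] is bounded. *)
Lemma prod_prime_factor_le (eps : R) : 0 < eps -> exists2 c, 0 < c &
  forall n, (1 < n)%N ->
  \prod_(0 <= p < n | prime p)
    (1 + (1 + ln p%:R `^ (3 + eps) / p%:R) * (3 * p%:R^-1 + 14 * p%:R^-1 ^+ 2))
  <= c * ln n%:R ^+ 3.
Proof.
move=> e0; have [c1 inv_le] := sum_inv_primes_le R.
have [c2 ln_le] := sum_inv_primes_ln_powR_le e0.
pose K1 := eps `^ eps; pose s := 3 + eps + eps; pose K2 := s `^ s.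
(* [14 * K1] bounds the term [14 x^2]; [10 * K2] bounds [W x (3 x + 14 x^2)], where [14 x <= 7]. The
   exponent [s] is that of [W * l]. *)
pose K := 14 * K1 + 10 * K2.
exists (expR (3 * c1 + K * c2)); first exact: expR_gt0.
move=> n n1; have l0 : 0 < ln n%:R :> R by exact: ln_nat_gt0.
have s0 : 0 < s by rewrite /s; lra.
have -> : expR (3 * c1 + K * c2) * ln n%:R ^+ 3
    = expR (3 * (ln (ln n%:R) + c1) + K * c2) :> R.
  have -> : 3 * (ln (ln n%:R) + c1) + K * c2
     = 3 * c1 + K * c2 + (ln (ln (n%:R : R)) + (ln (ln n%:R) + ln (ln n%:R))).
    by ring.
  by rewrite [RHS]expRD !(expRD (ln _)) !lnK ?posrE // exprS expr2.
pose T p : R := (p%:R * ln p%:R `^ eps)^-1.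
have K0 : 0 <= K.
  by rewrite addr_ge0 // mulr_ge0 ?powR_ge0.
have factor_le (p : nat) : prime p ->
    1 + (1 + ln p%:R `^ (3 + eps) / p%:R) * (3 * p%:R^-1 + 14 * p%:R^-1 ^+ 2)
    <= expR (3 * p%:R^-1 + K * T p) :> R.
  move=> pp; apply: le_trans (expR_ge1Dx _); rewrite lerD2l.
  have p0 : 0 < p%:R :> R by rewrite ltr0n prime_gt0.
  have lp0 : 0 < ln p%:R :> R by rewrite ln_nat_gt0 ?prime_gt1.
  pose x : R := p%:R^-1; have x0 : 0 < x by rewrite invr_gt0.
  have x2 : x <= 2^-1 by rewrite lef_pV2 ?posrE // (ler_nat _ 2) prime_gt1.
  pose l : R := ln p%:R `^ eps; have l0' : 0 < l by exact: powR_gt0.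
  pose W : R := ln p%:R `^ (3 + eps); have W0 : 0 < W by exact: powR_gt0.
  have TE : T p = x * l^-1 by rewrite /T invfM.
  have lK : l <= K1 * p%:R by apply: powR_ln_le; rewrite ?prime_gt0.
  have WK : W * l <= K2 * p%:R.
    rewrite /W /l -powRD; first by apply: powR_ln_le; rewrite ?prime_gt0.
    by apply/implyP => _; rewrite gt_eqF.
  have x2T : x ^+ 2 <= K1 * T p.
    rewrite TE expr2 mulrCA ler_pM2l // ler_pdivlMr // mulrC.
    by rewrite ler_pdivrMr.
  have WxT : W * x * x <= K2 * T p.
    rewrite TE mulrCA mulrC ler_pM2l // ler_pdivlMr // mulrAC.
    by rewrite ler_pdivrMr.
  rewrite -/x -/W /K.
  have : 0 <= W * x * x * (7 - 14 * x).
    by rewrite !mulr_ge0 ?(ltW W0) ?(ltW x0) //; lra.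
  lra.
apply: le_trans (_ : \prod_(0 <= p < n | prime p) expR (3 * p%:R^-1 + K * T p)
  <= _).
  apply: ler_prod => p pp; rewrite factor_le // andbT.
  by rewrite addr_ge0 // mulr_ge0 ?addr_ge0 // mulr_ge0 //
    ?exprn_ge0 ?invr_ge0 ?powR_ge0.
rewrite -expR_sum ler_expR big_split /= -!mulr_sumr lerD //.
  rewrite ler_pM2l //; apply: le_trans (inv_le n n1).
  rewrite [leRHS]big_mkcond big_nat_recr //= -big_mkcond lerDl.
  by case: ifP => // _; rewrite invr_ge0.
by rewrite ler_wpM2l.
Qed.

End LcmSums.

(** * Sets covered by progressions *)

Lemma progression_periodic (R : pzSemiRingType) (m M c : nat) : (m %| M)%N ->
  periodic M (fun x => (x == c %[mod m])%:R : R).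
Proof. by move=> mM; apply: periodic_dvd mM _ => x y ->. Qed.

Section CoveredSets.
Variables (R : realType) (Q k : nat) (r d : 'I_k -> nat).
Variables (mu delta : nat -> R).
Hypothesis Q_gt0 : (0 < Q)%N.
Hypothesis d_dvdQ : forall i, (d i %| Q)%N.
Hypothesis d_gt1 : forall i, (1 < d i)%N.
Hypothesis d_inj : injective d.
Hypothesis mu1 : mu 1%N = 1.
Hypothesis muM : forall a b, (0 < a)%N -> (0 < b)%N -> coprime a b ->
  mu (a * b)%N = mu a * mu b.
Hypothesis delta_ge0 : forall n, 0 <= delta n.
Hypothesis delta_le : forall n, delta n <= 2^-1.
Hypothesis mu_delta : forall p i, prime p -> (0 < i)%N ->
  (1 - delta p)^-1 <= mu (p ^ i)%N.

Definition covered n : pred nat := fun x =>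
  [exists i, (max_pdiv (d i) == n) && (x == r i %[mod d i])].

Local Notation q := (smooth_part Q).
Local Notation B := covered.
Local Notation E := (expect Q q B delta).
Local Notation G m := (mu m / m%:R).

Lemma top_factor i :
  let n := max_pdiv (d i) in
  exists2 u, (u %| q n)%N & d i = (u * n ^ logn n (d i))%N.
Proof.
move=> n; have pn : prime n := max_pdiv_prime (d_gt1 i).
have d0 : (0 < d i)%N := ltnW (d_gt1 i).
have [u cu du] := pfactor_coprime pn d0; exists u => //.
have ud : (u %| d i)%N by rewrite du dvdn_mulr.
apply: dvdn_smooth_part => //; first exact: dvdn_trans ud (d_dvdQ i).
move=> p pp pu; have : (p <= n)%N.
  by apply: max_pdiv_max; rewrite mem_primes pp d0 (dvdn_trans pu).
rewrite leq_eqVlt => /predU1P [pE|//].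
by move: cu; rewrite prime_coprime // -pE pu.
Qed.

Lemma top_exp_gt0 i : (0 < logn (max_pdiv (d i)) (d i))%N.
Proof.
rewrite logn_gt0 mem_primes max_pdiv_prime ?d_gt1 ?max_pdiv_dvd //.
by rewrite (ltnW (d_gt1 i)).
Qed.

Lemma d_dvd_smooth i : (d i %| q (max_pdiv (d i)).+1)%N.
Proof.
apply: dvdn_smooth_part => // p pp pd; rewrite ltnS.
by apply: max_pdiv_max; rewrite mem_primes pp pd (ltnW (d_gt1 i)).
Qed.

Lemma q_dvdQ n : (q n %| Q)%N. Proof. exact: smooth_part_dvd. Qed.

Lemma q_chain n : (q n %| q n.+1)%N.
Proof. by rewrite smooth_partS dvdn_mulr. Qed.

Lemma covered_periodic n : periodic (q n.+1) (B n).
Proof.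
move=> x y xy; apply: eq_existsb => i.
have [ni|//] := eqVneq (max_pdiv (d i)) n; rewrite /=.
have dq : (d i %| q n.+1)%N by rewrite -ni d_dvd_smooth.
by rewrite -(modn_dvdm x dq) xy modn_dvdm.
Qed.

Lemma covered_le n x :
  (B n x)%:R <= \sum_(i | max_pdiv (d i) == n) (x == r i %[mod d i])%:R :> R.
Proof.
have [/existsP [i /andP [ni xi]]|_] := boolP (B n x); last by rewrite sumr_ge0.
by rewrite (bigD1 i) //= xi lerDl sumr_ge0.
Qed.

Lemma expect_ge0 n f : (forall x, 0 <= f x) -> 0 <= E n f.
Proof.
by move=> f0; apply: mean_ge0 => x; rewrite mulr_ge0 ?f0 // weight_ge0.
Qed.

(** The measure before step [n] depends only on the residue mod [q n], so residues mod [n ^ t] are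
    still equidistributed and independent of it. *)
Lemma expect_progression_mul n u c t : prime n -> (u %| q n)%N ->
  (t <= logn n Q)%N ->
  E n (fun x => (x == c %[mod u * n ^ t])%:R)
  = (n ^ t)%:R^-1 * E n (fun x => (x == c %[mod u])%:R).
Proof.
move=> pn uq tQ; rewrite -expectZ.
apply: (expect_cmean _ Q_gt0 q_dvdQ q_chain covered_periodic) => x.
rewrite cmean_progression // 1?mulrC //.
  apply: dvdn_trans (q_dvdQ n.+1); rewrite smooth_partS dvdn_mul //.
  by rewrite dvdn_exp2l.
by rewrite coprimeXr // coprime_smooth_part.
Qed.

(** Induction on the steps: if the prime [n] divides [m], step [n] costs a factor at most
    [1 / (1 - delta n) <= mu (n ^ t)]; otherwise it preserves the mass. *)
Lemma expect_progression_le n m c : (m %| q n)%N ->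
  E n (fun x => (x == c %[mod m])%:R) <= G m.
Proof.
elim: n m c => [|n IHn] m c mq.
  move: mq; rewrite /smooth_part big_geq // dvdn1 => /eqP ->.
  rewrite mu1 divr1 -[leRHS](expect1 Q_gt0 q_dvdQ q_chain covered_periodic
    delta_ge0 delta_le 0).
  by apply: ler_expect => // x; rewrite !modn1.
have keep : (m %| q n)%N -> E n.+1 (fun x => (x == c %[mod m])%:R) <= G m.
  move=> mn; rewrite (expectS_periodic Q_gt0 q_dvdQ q_chain covered_periodic) //.
    exact: IHn.
  exact: progression_periodic.
have [pn|npn] := boolP (prime n); last first.
  by apply: keep; move: mq; rewrite smooth_partS lognE (negbTE npn) muln1.
have n0 := prime_gt0 pn.
have m0 : (0 < m)%N := dvdn_gt0 (smooth_part_gt0 Q n.+1) mq.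
have [u cu mE] := pfactor_coprime pn m0.
have uq : (u %| q n)%N.
  have : (u %| q n.+1)%N by apply: dvdn_trans mq; rewrite mE dvdn_mulr.
  by rewrite smooth_partS Gauss_dvdl // coprimeXr // coprime_sym.
have [t0|t0] := posnP (logn n m); first by apply: keep; rewrite mE t0 muln1.
have tQ : (logn n m <= logn n Q)%N.
  by apply: dvdn_leq_log => //; apply: dvdn_trans mq (q_dvdQ _).
rewrite mE; move: (logn n m) t0 tQ => t t0 tQ.
have d0 : 0 < 1 - delta n by have := delta_le n; lra.
have E0 : 0 <= E n (fun x => (x == c %[mod u])%:R) by apply: expect_ge0.
apply: (@le_trans _ _ ((1 - delta n)^-1 * E n (fun x => (x == c %[mod u * n ^
  t])%:R))).
  rewrite -expectZ; apply: ler_mean => // x.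
  rewrite weightS -mulrA ler_wpM2l ?weight_ge0 // ler_wpM2r //.
  exact: distortion_le.
rewrite expect_progression_mul //
  muM ?expn_gt0 ?n0 ?(dvdn_gt0 _ uq) ?smooth_part_gt0 //;
  last by rewrite coprimeXr // coprime_sym.
have -> : mu u * mu (n ^ t)%N / (u * n ^ t)%:R
  = mu (n ^ t)%N * ((n ^ t)%:R^-1 * G u).
  by rewrite natrM invfM; ring.
apply: ler_pM; first by rewrite invr_ge0 ltW.
- by apply: mulr_ge0 => //; rewrite invr_ge0.
- exact: mu_delta.
- by rewrite ler_wpM2l ?invr_ge0 // IHn.
Qed.

(** The quantity bounds the mass of a progression from above, so its sign needs no separate study of
    [mu]. *)
Lemma progression_weight_ge0 n m : (m %| q n)%N -> 0 <= G m.
Proof.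
by move=> /(expect_progression_le 0); apply: le_trans; apply: expect_ge0.
Qed.

Lemma expect_progression2_le n u v a b : (u %| q n)%N -> (v %| q n)%N ->
  E n (fun x => (x == a %[mod u])%:R * (x == b %[mod v])%:R) <= G (lcmn u v).
Proof.
move=> uq vq; have lq : (lcmn u v %| q n)%N by rewrite dvdn_lcm uq.
have [[z /andP [/eqP za /eqP zb]]|none] :=
    pselect (exists z, (z == a %[mod u]) && (z == b %[mod v])).
  apply: le_trans (expect_progression_le z lq).
  apply: ler_expect => // x; rewrite modn_lcm -za -zb.
  by rewrite -natrM mulnb.
apply: le_trans (progression_weight_ge0 lq).
have -> : 0 = E n (fun=> 0) by rewrite -[0 in RHS](mul0r 0) expectZ mul0r.
apply: ler_expect => // x; rewrite -natrM mulnb.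
by case: andP => // -[xa xb]; case: none; exists x; rewrite xa xb.
Qed.

Lemma top_le i : (logn (max_pdiv (d i)) (d i) <= logn (max_pdiv (d i)) Q)%N.
Proof. exact: dvdn_leq_log. Qed.

Lemma expect_covered_le n :
  E n (fun x => (B n x)%:R) <= \sum_(i | max_pdiv (d i) == n) G (d i).
Proof.
apply: le_trans (_ : E n (fun x => \sum_(i | max_pdiv (d i) == n)
                                     (x == r i %[mod d i])%:R) <= _).
  by apply: ler_expect => // x; exact: covered_le.
rewrite expect_sum; apply: ler_sum => i /eqP <-.
set p := max_pdiv (d i); have pp : prime p := max_pdiv_prime (d_gt1 i).
have p0 := prime_gt0 pp.
have [u uq dE] := top_factor i; have t0 := top_exp_gt0 i.
have tQ := top_le i; rewrite -/p in uq dE t0 tQ.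
rewrite dE; move: (logn p (d i)) t0 tQ => t t0 tQ.
rewrite expect_progression_mul //
  muM ?expn_gt0 ?p0 ?(dvdn_gt0 _ uq) ?smooth_part_gt0 //;
  last by rewrite coprimeXr // (coprime_dvdl uq) ?coprime_smooth_part.
have d0 : 0 < 1 - delta p by have := delta_le p; lra.
(* Step [p] has not been taken yet, so the factor [mu (p ^ t)] is simply inserted as a number at
   least 1. *)
have mu_ge1 : 1 <= mu (p ^ t)%N.
  apply: le_trans (mu_delta pp t0); rewrite invf_ge1 //.
  by have := delta_ge0 p; lra.
have -> : mu u * mu (p ^ t)%N / (u * p ^ t)%:R
  = (p ^ t)%:R^-1 * (mu (p ^ t)%N * G u).
  by rewrite natrM invfM; ring.
rewrite ler_wpM2l ?invr_ge0 //; apply: le_trans (expect_progression_le _ uq) _.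
by rewrite ler_peMl // (progression_weight_ge0 uq).
Qed.

Lemma expect_covered_uniform_le n : (forall m, (m < n)%N -> delta m = 0) ->
  E n (fun x => (B n x)%:R) <= \sum_(i | max_pdiv (d i) == n) (d i)%:R^-1.
Proof.
move=> d0.
apply: le_trans (_ : E n (fun x => \sum_(i | max_pdiv (d i) == n)
                                     (x == r i %[mod d i])%:R) <= _).
  by apply: ler_expect => // x; exact: covered_le.
rewrite expect_sum; apply: ler_sum => i _.
have -> : E n (fun x => (x == r i %[mod d i])%:R)
    = mean Q (fun x => (x == r i %[mod d i])%:R).
  apply: eq_mean => x; rewrite /weight big1 ?mul1r // => m _.
  by rewrite distortion_delta0 ?d0.
rewrite /mean; under eq_bigr do rewrite mulrb.
rewrite -big_mkcond /= sum_residue_class // mulrAC divff ?mul1r //.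
by rewrite pnatr_eq0 -lt0n.
Qed.

Lemma alpha_le n x : alpha R Q q B n x <=
  \sum_(i | max_pdiv (d i) == n)
    (n ^ logn n (d i))%:R^-1 * (x == r i %[mod d i %/ n ^ logn n (d i)])%:R.
Proof.
apply: le_trans (ler_cmean Q (q n) x (covered_le n)) _.
rewrite cmean_sum; apply: ler_sum => i /eqP <-.
set p := max_pdiv (d i); have pp : prime p := max_pdiv_prime (d_gt1 i).
have [u uq dE] := top_factor i; have tQ := top_le i; rewrite -/p in uq dE tQ.
move: (logn p (d i)) dE tQ => t -> tQ.
rewrite mulnK ?expn_gt0 ?prime_gt0 // cmean_progression // 1?mulrC //.
  apply: dvdn_trans (q_dvdQ p.+1); rewrite smooth_partS dvdn_mul //.
  by rewrite dvdn_exp2l.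
by rewrite coprimeXr // coprime_smooth_part.
Qed.

Lemma expect_alpha_sqr_le n : prime n ->
  E n (fun x => alpha R Q q B n x ^+ 2)
  <= (n%:R - 1)^-1 ^+ 2 * lcm_sum (fun m => G m) (q n).
Proof.
move=> pn; have n0 := prime_gt0 pn; have n1 := prime_gt1 pn.
(* Setting [c] to 0 off the multiples of [n] lets the sum run over all divisors of [q n.+1]. *)
pose c e : R := if (n %| e)%N then (n ^ logn n e)%:R^-1 else 0.
pose u e := (e %/ n ^ logn n e)%N.
have c0 e : 0 <= c e by rewrite /c; case: ifP => // _; rewrite invr_ge0.
pose H e e' := c e * (c e' * G (lcmn (u e) (u e'))).
have u_dvd e : (e %| q n.+1)%N -> (u e %| q n)%N.
  move=> eq; have e0 : (0 < e)%N := dvdn_gt0 (smooth_part_gt0 Q n.+1) eq.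
  have [v cv eE] := pfactor_coprime pn e0.
  have -> : u e = v by rewrite /u {1}eE mulnK ?expn_gt0 ?n0.
  have : (v %| q n.+1)%N by apply: dvdn_trans eq; rewrite eE dvdn_mulr.
  by rewrite smooth_partS Gauss_dvdl // coprimeXr // coprime_sym.
have H0 e e' : (e %| q n.+1)%N -> (e' %| q n.+1)%N -> 0 <= H e e'.
  move=> eq eq'; do 2!apply: mulr_ge0 => //;
    apply: (progression_weight_ge0 (n := n)).
  by rewrite dvdn_lcm !u_dvd.
pose P := fun i : 'I_k => max_pdiv (d i) == n.
have dq i : P i -> d i \in divisors (q n.+1).
  by move=> /eqP <-; rewrite -dvdn_divisors ?smooth_part_gt0 ?d_dvd_smooth.
have cd i : P i -> c (d i) = (n ^ logn n (d i))%:R^-1.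
  by move=> /eqP ni; rewrite /c -{1}ni max_pdiv_dvd.
apply: (@le_trans _ _ (\sum_(i | P i) \sum_(j | P j) H (d i) (d j))).
  apply: le_trans (_ : E n (fun x => \sum_(i | P i) \sum_(j | P j)
      c (d i) * c (d j) * ((x == r i %[mod u (d i)])%:R * (x == r j %[mod u (d
        j)])%:R)) <= _).
    apply: ler_expect => // x; rewrite expr2.
    apply: le_trans (ler_pM _ _ (alpha_le n x) (alpha_le n x)) _;
      rewrite ?alpha_ge0 //.
    rewrite mulr_suml; apply: ler_sum => i Pi; rewrite mulr_sumr;
      apply: ler_sum => j Pj.
    by rewrite !cd // mulrACA.
  rewrite expect_sum; apply: ler_sum => i Pi; rewrite expect_sum;
    apply: ler_sum => j Pj.
  rewrite expectZ /H mulrA ler_wpM2l ?mulr_ge0 //.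
  have [iq jq] := (dq i Pi, dq j Pj);
    rewrite -!dvdn_divisors ?smooth_part_gt0 // in iq jq.
  by apply: expect_progression2_le; exact: u_dvd.
apply: (@le_trans _ _ (\sum_(e <- divisors (q n.+1)) \sum_(e' <- divisors (q
  n.+1)) H e e')).
  apply: (@le_trans _ _ (\sum_(e <- divisors (q n.+1)) \sum_(j | P j) H e (d j))).
    apply: (ler_sum_inj (F := fun e => \sum_(j | P j) H e (d j))) => //.
      exact: divisors_uniq.
    move=> e; rewrite -dvdn_divisors ?smooth_part_gt0 // => eq.
    apply: sumr_ge0 => j /dq; rewrite -dvdn_divisors ?smooth_part_gt0 // => jq.
    exact: H0.
  rewrite big_seq [leRHS]big_seq; apply: ler_sum => e.
  rewrite -dvdn_divisors ?smooth_part_gt0 // => eq.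
  apply: (ler_sum_inj (F := H e)) => //; first exact: divisors_uniq.
  by move=> e'; rewrite -dvdn_divisors ?smooth_part_gt0 //; exact: H0.
pose x : R := n%:R^-1.
pose g t : R := if (0 < t)%N then x ^+ t else 0.
have split_un v t : v \in divisors (q n) ->
    c (v * n ^ t)%N = g t /\ u (v * n ^ t)%N = v.
  rewrite -dvdn_divisors ?smooth_part_gt0 // => vq.
  have v0 : (0 < v)%N := dvdn_gt0 (smooth_part_gt0 Q n) vq.
  have cv : coprime n v.
    by rewrite coprime_sym; apply: coprime_dvdl vq (coprime_smooth_part Q pn).
  have lt : logn n (v * n ^ t)%N = t.
    by rewrite lognM ?expn_gt0 ?n0 // pfactorK // logn_coprime.
  rewrite /c /u lt mulnK ?expn_gt0 ?n0 //; split => //.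
  rewrite /g Gauss_dvdr // natrX exprVn; case: t {lt} => [|t] /=.
    by rewrite dvdn1 gtn_eqF.
  by rewrite expnS dvdn_mulr.
(* Writing [e = v * n ^ t] separates the powers of [n] from the cofactors; the series of [n ^ -t]
   over [t >= 1] is at most [1 / (n - 1)]. *)
have -> : \sum_(e <- divisors (q n.+1)) \sum_(e' <- divisors (q n.+1)) H e e'
    = (\sum_(t < (logn n Q).+1) g t) ^+ 2 * lcm_sum (fun m => G m) (q n).
  rewrite sum_divisors_smoothS // /lcm_sum mulr_sumr; apply: eq_big_seq => v vq.
  rewrite expr2 -mulrA mulr_suml; apply: eq_bigr => s _.
  rewrite sum_divisors_smoothS // mulr_sumr mulr_sumr; apply: eq_big_seq => v' vq'.
  rewrite mulr_suml mulr_sumr; apply: eq_bigr => t _.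
  rewrite /H; have [-> ->] := split_un v s vq.
  by have [-> ->] := split_un v' t vq'.
have lcm0 : 0 <= lcm_sum (fun m => G m) (q n).
  rewrite /lcm_sum big_seq; apply: sumr_ge0 => v vq; rewrite big_seq.
  apply: sumr_ge0 => v' vq'; rewrite -!dvdn_divisors ?smooth_part_gt0 // in vq vq'.
  by apply: (progression_weight_ge0 (n := n)); rewrite dvdn_lcm vq.
rewrite ler_wpM2r // ler_sqr ?nnegrE.
- rewrite big_ord_recl /= add0r.
  have nR : 1 < n%:R :> R by rewrite ltr1n.
  have xn : x * n%:R = 1 by rewrite mulVf // gt_eqF // (lt_trans ltr01).
  have x0 : 0 < x by rewrite invr_gt0 (lt_trans ltr01).
  under eq_bigr do rewrite /g /= exprS.
  rewrite -mulr_sumr; set S := \sum_(i < _) _.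
  have := subrX1 x (logn n Q); rewrite -/S => SE.
  have := exprn_ge0 (logn n Q) (ltW x0) => xl.
  rewrite -[leRHS]mul1r ler_pdivlMr ?subr_gt0 //.
  have -> : x * S * (n%:R - 1) = (x * n%:R) * S - x * S by ring.
  by rewrite xn mul1r; lra.
- by apply: sumr_ge0 => t _; rewrite /g; case: ifP => // _;
  rewrite exprn_ge0 ?invr_ge0.
- by rewrite invr_ge0 subr_ge0 ler1n.
Qed.

End CoveredSets.

(** * Choice of the constants and conclusion *)

Lemma nonneg_bounded_tail (R : realType) (f : nat -> R) (P : pred nat) (c e : R) :
  (forall n, P n -> 0 <= f n) ->
  (forall n, \sum_(0 <= p < n | P p) f p <= c) -> 0 < e ->
  exists m, forall n, \sum_(m <= p < n | P p) f p <= e.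
Proof.
move=> f0 fc e0; pose S n := \sum_(0 <= p < n | P p) f p.
have hS : has_sup (range S).
  split; first by exists (S 0%N), 0%N.
  by exists c => _ [n _ <-]; exact: fc.
(* A partial sum within [e] of the supremum leaves tails of at most [e]. *)
have [_ [m _ <-] Sm] := sup_adherent e0 hS.
exists m => n; have [mn|/ltnW nm] := leqP m n; last by rewrite big_geq // ltW.
have : S n <= sup (range S) by apply: sup_upper_bound => //; exists n.
rewrite /S (big_cat_nat (n := m)) //= -/(S m); lra.
Qed.

Lemma sum_fibers (R : nmodType) (I : finType) (N : nat) (g : I -> nat)
    (F : nat -> I -> R) : (forall i, (g i < N)%N) ->
  \sum_(n < N) \sum_(i | g i == n) F n i = \sum_i F (g i) i.
Proof.
move=> gN; rewrite (exchange_big_dep predT) //=; apply: eq_bigr => i _.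
rewrite (bigD1 (Ordinal (gN i))) ?eqxx //= big1 ?addr0 // => n /andP [/eqP gn /eqP].
by case; apply: val_inj => /=.
Qed.

(** Rankin's trick: [d >= M] gives [1 / d <= M^(-1/2) * d^(-1/2)], and the smooth sum of [d^(-1/2)]
    is at most [b <= M^(1/2) / 4]. *)
Lemma sum_large_smooth_le (R : realType) (Q P k : nat) (d : 'I_k -> nat) (b M : R) :
  (0 < Q)%N -> 0 <= b -> 0 < M ->
  \prod_(0 <= p < P | prime p) (1 - (Num.sqrt p%:R)^-1)^-1 <= b ->
  (4 * b) ^+ 2 <= M -> injective d -> (forall i, M <= (d i)%:R) ->
  (forall i, (d i %| Q)%N) -> (forall i, (1 < d i)%N) ->
  \sum_(i | (max_pdiv (d i) < P)%N) (d i)%:R^-1 <= (4 : R)^-1.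
Proof.
move=> Q0 b0 M0 prod_le bM dI dM dQ d1.
pose F m : R := (Num.sqrt M)^-1 * (Num.sqrt m%:R)^-1.
have sM0 : 0 < Num.sqrt M by rewrite sqrtr_gt0.
apply: le_trans (_ : \sum_(i | (max_pdiv (d i) < P)%N) F (d i) <= _).
  apply: ler_sum => i _; have di0 : 0 < (d i)%:R :> R by rewrite ltr0n ltnW.
  rewrite /F -invfM lef_pV2 ?posrE ?mulr_gt0 ?sqrtr_gt0 //.
  rewrite -[leRHS](sqr_sqrtr (ltW di0)) expr2 ler_wpM2r ?sqrtr_ge0 //.
  by rewrite ler_wsqrtr.
apply: le_trans (_ : \sum_(m <- divisors (smooth_part Q P)) F m <= _).
  apply: ler_sum_inj => // [|m _|i dP]; first exact: divisors_uniq.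
    by rewrite mulr_ge0 ?invr_ge0 ?sqrtr_ge0.
  rewrite -dvdn_divisors ?smooth_part_gt0 //; apply: dvdn_smooth_part => // p pp pd.
  apply: leq_ltn_trans dP; apply: max_pdiv_max.
  by rewrite mem_primes pp pd (ltnW (d1 i)).
rewrite -mulr_sumr ler_pdivrMl //.
apply: le_trans (sum_smooth_inv_sqrt_le _ _ _) _; apply: le_trans prod_le _.
rewrite ler_pdivlMr // mulrC -[leLHS](@ger0_norm R) ?mulr_ge0 // -sqrtr_sqr.
by rewrite ler_wsqrtr.
Qed.

Lemma uncovered_residues_density_ge (R : realType) (eps : R) : 0 < eps ->
  exists M : R, 2 <= M /\
  forall mu : nat -> R,
    multiplicative_function mu -> prime_power_weight eps mu ->
  forall (Q k : nat) (r d : 'I_k -> nat), (0 < Q)%N -> (forall i, (d i %| Q)%N) ->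
    injective d -> (forall i, M <= (d i)%:R) ->
  expR (- (4 * \sum_(i < k) mu (d i) / (d i)%:R)) / 2
  <= mean Q (fun x => [forall i, ~~ (x == r i %[mod d i])]%:R).
Proof.
move=> e0; pose s : R := 3 + eps; pose K := s `^ s.
have s0 : 0 < s by rewrite /s; lra.
have K0 : 0 <= K by exact: powR_ge0.
pose w (p : nat) : R := ln p%:R `^ s / p%:R.
have w_ge0 p : 0 <= w p by rewrite divr_ge0 ?powR_ge0.
have w_le p : w p <= K.
  have [->|p0] := posnP p; first by rewrite /w invr0 mulr0.
  by rewrite ler_pdivrMr ?ltr0n //; exact: powR_ln_le.
have [c c0 prod_le] := prod_prime_factor_le e0.
have [c2 T_le] := sum_inv_primes_ln_powR_le e0.
pose T (p : nat) : R := (p%:R * ln p%:R `^ eps)^-1.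
(* The factor [c] comes from the lcm sum, 4 from [1 / (n - 1) <= 2 / n] squared, and [1 + K] from
   [1 / (2 * delta n)]. *)
pose K2 := 4 * c * (1 + K).
have K2_gt0 : 0 < K2 by rewrite !mulr_gt0 //; lra.
have [P tail] : exists P, forall n,
    \sum_(P <= p < n | prime p) T p <= (4 * K2)^-1.
  apply: (@nonneg_bounded_tail _ _ _ c2) => // [p _|].
    by rewrite invr_ge0 mulr_ge0 ?powR_ge0.
  by rewrite invr_gt0 mulr_gt0.
pose b : R := \prod_(0 <= p < P | prime p) (1 - (Num.sqrt p%:R)^-1)^-1.
have b0 : 0 <= b.
  apply: prodr_ge0 => p pp; rewrite invr_ge0 subr_ge0 invf_le1 ?sqrtr_gt0
    ?ltr0n ?prime_gt0 //.
  by rewrite -[leLHS]sqrtr1 ler_wsqrtr // ler1n prime_gt0.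
(* The square makes the smooth contribution at most 1/4; the summand 2 forces every modulus to
   exceed 1. *)
pose M := (4 * b) ^+ 2 + 2; have bM : (4 * b) ^+ 2 <= M by rewrite /M; lra.
have M2 : 2 <= M by have := sqr_ge0 (4 * b); rewrite /M; lra.
exists M; split=> // mu [mu1 muM] muX Q k r d Q0 dQ dI dM.
have muw p i : prime p -> (0 < i)%N -> mu (p ^ i)%N = 1 + w p by exact: muX.
have d1 i : (1 < d i)%N by rewrite -(ltr_nat R); have := dM i; lra.
(* As [w p <= K], this divisor gives both [delta p <= 1/2] and [delta p <= w p / 2], which imply
   [1 / (1 - delta p) <= 1 + w p]. *)
pose delta p : R := if prime p && (P <= p)%N then w p / (2 * (1 + K)) else 0.
have K1 : 0 < 2 * (1 + K) by lra.
have delta_ge0 p : 0 <= delta p.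
  by rewrite /delta; case: ifP => // _; rewrite divr_ge0 // ltW.
have delta_le p : delta p <= 2^-1.
  rewrite /delta; case: ifP => _; last by lra.
  by rewrite ler_pdivrMr //; have := w_le p; lra.
have delta_le_w p : delta p <= w p / 2.
  rewrite /delta; case: ifP => _; last by rewrite divr_ge0.
  rewrite ler_wpM2l // lef_pV2 ?posrE //; lra.
have mu_delta p i : prime p -> (0 < i)%N -> (1 - delta p)^-1 <= mu (p ^ i)%N.
  move=> pp i0; rewrite muw // -[leLHS]mul1r ler_pdivrMr.
    have := delta_le p; have := delta_le_w p; have := w_ge0 p; have := delta_ge0 p.
    by nra.
  by have := delta_le p; lra.
pose q := smooth_part Q; pose B := covered r d.

have q_dvd : forall n, (q n %| Q)%N by move=> n; exact: smooth_part_dvd.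
have q_ch : forall n, (q n %| q n.+1)%N by exact: q_chain.
have B_per : forall n, periodic (q n.+1) (B n) by exact: covered_periodic.
have max_lt i : (max_pdiv (d i) < Q.+1)%N.
  rewrite ltnS; apply: leq_trans (dvdn_leq Q0 (dQ i)).
  by apply: max_pdiv_leq; exact: ltnW.
have G0 i : 0 <= mu (d i) / (d i)%:R.
  apply: (@progression_weight_ge0 R Q k r d mu delta Q0 dQ d1 mu1 muM delta_ge0
     delta_le mu_delta (max_pdiv (d i)).+1).
  exact: d_dvd_smooth.
apply: le_trans (uncovered_mean_ge Q0 q_dvd q_ch B_per delta_ge0 delta_le
  (N := Q.+1) _ _ _) _.
- by apply: sumr_ge0 => i _; exact: G0.
(* [F] collects the primes below [P] and [T'] those from [P] on; each part totals at most 1/4. *)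
- pose F n i : R := if (n < P)%N then (d i)%:R^-1 else 0.
  pose T' n : R := if prime n && (P <= n)%N then K2 * T n else 0.
  apply: le_trans (_ : \sum_(n < Q.+1)
      (\sum_(i | max_pdiv (d i) == n) F n i + T' n) <= _).
    apply: ler_sum => n _.
    have [nP|Pn] := ltnP n P.
      have dn m : (m <= n)%N -> delta m = 0.
        by move=> mn; rewrite /delta leqNgt (leq_ltn_trans mn nP) andbF.
      rewrite /T' leqNgt nP andbF addr0 expectS_B_delta0 ?dn //.
      apply: le_trans (expect_covered_uniform_le r Q0 dQ delta_ge0 delta_le _) _.
        by move=> m /ltnW; exact: dn.
      by apply: ler_sum => i _; rewrite /F nP.
    have F0 : 0 <= \sum_(i | max_pdiv (d i) == n) F n i.
      by apply: sumr_ge0 => i _; rewrite /F; case: ifP.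
    apply: le_trans (_ : T' n <= _); last by rewrite lerDr.
    (* At a non-prime [n] no modulus has largest prime factor [n], so the mass of [B n] is 0. *)
    rewrite /T' Pn andbT; case: ifPn => pn; last first.
      have d0 : delta n = 0 by rewrite /delta (negbTE pn).
      rewrite expectS_B_delta0 //.
      apply: le_trans (expect_covered_le r Q0 dQ d1 mu1 muM delta_ge0 delta_le
        mu_delta n) _.
      rewrite big1 // => i /eqP mi; move: pn.
      by rewrite -mi max_pdiv_prime.
    have n1 := prime_gt1 pn.
    have nR : 2 <= n%:R :> R by rewrite (ler_nat _ 2).
    have l0 : 0 < ln n%:R :> R by exact: ln_nat_gt0.
    have w0 : 0 < w n by rewrite divr_gt0 ?powR_gt0 //; lra.
    have dE : delta n = w n / (2 * (1 + K)) by rewrite /delta pn Pn.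
    have dn : 0 < delta n by rewrite dE divr_gt0.
    apply: le_trans (expectS_B_le Q0 q_dvd q_ch B_per delta_ge0 delta_le dn) _.
    have S_le : lcm_sum (fun m => mu m / m%:R) (q n) <= c * ln n%:R ^+ 3.
      apply: le_trans (lcm_sum_le Q n muM mu1 w_ge0 muw) _; exact: prod_le.
    have A_le := expect_alpha_sqr_le r Q0 dQ d1 dI mu1 muM delta_ge0 delta_le
      mu_delta pn.
    apply: le_trans (ler_wpM2l _ A_le) _; first by rewrite invr_ge0 mulr_ge0.
    apply: le_trans (ler_wpM2l _ (ler_wpM2l _ S_le)) _;
      rewrite ?exprn_ge0 ?invr_ge0 ?mulr_ge0 ?subr_ge0 //; first lra.
    have sq : (n%:R - 1)^-1 ^+ 2 <= 4 * n%:R^-1 ^+ 2 :> R.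
      have -> : 4 * n%:R^-1 ^+ 2 = (n%:R / 2)^-1 ^+ 2 :> R.
        by field; lra.
      rewrite ler_sqr ?nnegrE ?invr_ge0; [rewrite lef_pV2 ?posrE | |]; lra.
    apply: le_trans (ler_wpM2l _ (ler_wpM2r _ sq)) _;
      rewrite ?invr_ge0 ?mulr_ge0 ?exprn_ge0 ?(ltW c0) ?(ltW l0) //.
    rewrite le_eqVlt; apply/orP; left; apply/eqP.
    rewrite dE /K2 /T /w /s powRD; last by apply/implyP => _; rewrite gt_eqF.
    rewrite (_ : ln n%:R `^ 3 = ln n%:R ^+ 3 :> R); last first.
      by rewrite -powR_mulrn // ltW.
    have := powR_gt0 eps l0; move: (ln n%:R `^ eps) => l l0'.
    move: (ln n%:R) l0 => y y0; move: (n%:R) nR => z z2.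
    by field; rewrite !gt_eqF //; lra.
  rewrite big_split /= sum_fibers //.
  have -> : \sum_i F (max_pdiv (d i)) i
    = \sum_(i | (max_pdiv (d i) < P)%N) (d i)%:R^-1.
    by rewrite [RHS]big_mkcond.
  have small := sum_large_smooth_le Q0 b0 _ (lexx _) bM dI dM dQ d1.
  have : \sum_(n < Q.+1) T' n <= 4^-1.
    have -> : \sum_(n < Q.+1) T' n = K2 * \sum_(P <= p < Q.+1 | prime p) T p.
      rewrite mulr_sumr big_geq_mkord [RHS]big_mkcond /=; apply: eq_bigr => n _.
      by rewrite /T' andbC.
    by rewrite -ler_pdivlMl // -invfM [K2 * _]mulrC; exact: tail.
  have := small; lra.
- rewrite -(@sum_fibers _ _ Q.+1 (fun i => max_pdiv (d i)) (fun _ i => mu (d i)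
  / (d i)%:R)) //.
  by apply: ler_sum => n _; apply: expect_covered_le.
(* Every largest prime factor is at most [Q], so a point outside all [B n] with [n <= Q] avoids all
   progressions. *)
apply: ler_mean => // x; rewrite ler_nat.
case: forallP => [_|nAP]; first exact: leq_b1.
rewrite leqn0 eqb0; apply/negP => /forallP nB; case: nAP => i.
apply/negP => xi; have /negP := nB (Ordinal (max_lt i)); apply.
by apply/existsP; exists i; rewrite eqxx.
Qed.

(** Since each [d i] divides [Q], a residue avoiding all progressions has its whole class mod [Q]
    uncovered. Each [a i] is reduced mod [d i] to a natural number for the comparison on [nat]. *)
Lemma density_mod_ge_mean (R : realType) (Q k : nat) (a : 'I_k -> int) (d :
  'I_k -> nat) :
  (0 < Q)%N -> (forall i, (0 < d i)%N) -> (forall i, (d i %| Q)%N) ->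
  mean Q (fun x => [forall i, ~~ (x == `|(a i %% d i)%Z|%N %[mod d i])]%:R)
  <= density_mod R Q (uncovered a d).
Proof.
move=> Q0 d0 dQ; rewrite /density_mod /mean ler_pM2r ?invr_gt0 ?ltr0n //.
rewrite -sum1_card natr_sum [leRHS]big_mkcond /=; apply: ler_sum => x _.
case: forallP => [nA|_] /=; last by case: ifP.
case: ifPn => // /negP []; apply/asboolP => _ [z ->] [i _ [z' E]];
  have /negP := nA i; apply.
have di0 : (d i)%:Z != 0 by rewrite eqz_nat -lt0n.
have xE : (x : nat)%:Z = (z' - (Q %/ d i)%N%:Z * z) * (d i)%:Z + a i.
  have QE : Q%:Z = (Q %/ d i)%N%:Z * (d i)%:Z by rewrite -PoszM divnK.
  by move: E; rewrite QE; lia.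
have : ((x : nat)%:Z %% d i)%Z = (a i %% d i)%Z by rewrite xE modzMDl.
rewrite modz_nat => <-; rewrite absz_nat.
by rewrite modn_mod.
Qed.

Theorem theorem1p1 (R : realType) (eps : R) (eps_gt0 : 0 < eps) :
  exists M : R, 0 < M /\
  forall mu : nat -> R,
    multiplicative_function mu -> prime_power_weight eps mu ->
  forall (k : nat) (a : 'I_k -> int) (d : 'I_k -> nat),
    injective d -> (forall i : 'I_k, M <= (d i)%:R) ->
  forall C : R, C = \sum_(i < k) mu (d i) / (d i)%:R ->
    expR (- (4 * C)) / 2 <= density_mod R (lcm_moduli d) (uncovered a d).
Proof.
have [M [M2 main]] := uncovered_residues_density_ge eps_gt0.
exists M; split; first by lra.
move=> mu muM muX k a d dI dM C ->.
have d0 i : (0 < d i)%N by rewrite -(ltr_nat R); have := dM i; lra.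
have Q0 : (0 < lcm_moduli d)%N.
  by apply: (big_ind (fun m => (0 < m)%N)) => // m n m0 n0; rewrite lcmn_gt0 m0.
have dQ i : (d i %| lcm_moduli d)%N by exact: biglcmn_sup.
refine (le_trans _ (@density_mod_ge_mean R _ _ a d Q0 d0 dQ)).
exact: main.
Qed.
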